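(* Let $t_0,t_1,T\in\mathbb{R}$ be such that $0<t_0<t_1<T$, let $I\subseteq\mathbb{R}$ be a non-empty open interval, and let $\Omega:=(t_0,t_1)\times I$. Suppose that $u\in C^0([0,T),H^s(\mathbb{R}))$, $s>3/2$, is a solution of $$u_t-u_{txx}+uu_x-uu_{xxx}=0.$$ If $u$ is either non-negative or non-positive and $u\big|_{\Omega}=0$, then $u\equiv0$ on $[0,T)\times\mathbb{R}$ and, moreover, $u$ can be extended globally (as a solution defined for all $t\geq0$).
   Context: $H^s(\mathbb{R})$ is the usual Sobolev space. For $s>3/2$ the equation is understood in its equivalent non-local form $u_t+uu_x+\partial_x\Lambda^{-2}\left(\tfrac32u_x^2\right)=0$, where $\Lambda^{-2}f=g\ast f$ with $g(x)=e^{-|x|}/2$ (so $\Lambda^2=1-\partial_x^2$); solutions are those provided by local well-posedness, i.e. $u\in C^0([0,T);H^s(\mathbb{R}))\cap C^1([0,T);H^{s-1}(\mathbb{R}))$, unique for given initial data. *)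

(* Defs.v *)
From HB Require Import structures.
From mathcomp Require Import all_boot all_order all_algebra.
From mathcomp Require Import all_classical all_reals all_analysis.

Set Implicit Arguments.
Unset Strict Implicit.
Unset Printing Implicit Defensive.

Import Order.TTheory GRing.Theory Num.Theory.
Import numFieldNormedType.Exports.

Local Open Scope classical_set_scope.
Local Open Scope ring_scope.

Definition L2norm (R : realType) (f : R -> R) : \bar R :=
  ('N[@lebesgue_measure R]_(2%:E) [EFin \o f])%E.

Definition L2 (R : realType) (f : R -> R) : Prop :=
  f \in Lfun (@lebesgue_measure R) 2%:E.

(* Real and imaginary parts of
   (2 pi)^(-1/2) \int_{-n}^{n} f(x) e^{- i x xi} dx. *)
Definition fourier_trunc_re (R : realType) (f : R -> R) (n : nat) (xi : R) : R :=
  (Num.sqrt (2 * pi))^-1 *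
  \int[@lebesgue_measure R]_(x in `[- n%:R, n%:R]) (f x * cos (x * xi)).

Definition fourier_trunc_im (R : realType) (f : R -> R) (n : nat) (xi : R) : R :=
  - ((Num.sqrt (2 * pi))^-1 *
     \int[@lebesgue_measure R]_(x in `[- n%:R, n%:R]) (f x * sin (x * xi))).

(* a + i b is the Fourier-Plancherel transform of the real-valued function
   f in L^2(R), i.e. the L^2 limit of the truncated Fourier integrals.  By
   Plancherel's theorem it exists for every f in L^2, and it is unique up to
   a.e. equality. *)
Definition is_fourier (R : realType) (f a b : R -> R) : Prop :=
  [/\ L2 f, L2 a, L2 b,
      L2norm (fun xi => fourier_trunc_re f n xi - a xi) @[n --> \oo] --> 0%E &
      L2norm (fun xi => fourier_trunc_im f n xi - b xi) @[n --> \oo] --> 0%E].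

(* The Sobolev norm || (1 + xi^2)^(s/2) \hat f ||_{L^2}, for s >= 0.  The
   infimum only serves to name the common value for all representatives
   a + i b of \hat f; it is +oo when f is not in L^2. *)
Definition Hs_norm (R : realType) (s : R) (f : R -> R) : \bar R :=
  ereal_inf [set N | exists a b : R -> R, is_fourier f a b /\
    N = L2norm (fun xi => (1 + xi ^+ 2) `^ (s / 2) *
                          Num.sqrt (a xi ^+ 2 + b xi ^+ 2))].

Definition Hs (R : realType) (s : R) (f : R -> R) : Prop :=
  L2 f /\ (Hs_norm s f < +oo)%E.

(* u in C^0(J; H^s(R)), where u t is the function x |-> u(t, x). *)
Definition C0_Hs (R : realType) (s : R) (J : set R) (u : R -> R -> R) : Prop :=
  (forall t, J t -> Hs s (u t)) /\
  (forall t, J t ->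
     Hs_norm s (fun x => u t' x - u t x) @[t' --> within J (nbhs t)] --> 0%E).

(* u in C^1(J; H^s(R)) with derivative v; the derivative is one-sided at an
   endpoint of J belonging to J. *)
Definition C1_Hs (R : realType) (s : R) (J : set R) (u v : R -> R -> R) : Prop :=
  [/\ C0_Hs s J u, C0_Hs s J v &
      forall t, J t ->
        Hs_norm s (fun x => (t' - t)^-1 * (u t' x - u t x) - v t x)
          @[t' --> within J t^'] --> 0%E].

(* Lambda^{-2} f = g * f with g(x) = e^{-|x|} / 2. *)
Definition Lambda_inv2 (R : realType) (f : R -> R) (x : R) : R :=
  \int[@lebesgue_measure R]_y (expR (- `|x - y|) / 2 * f y).

(* Solutions of u_t + u u_x + d_x Lambda^{-2} (3/2 u_x^2) = 0, the non-local
   form of u_t - u_txx + u u_x - u u_xxx = 0, in the class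
   C^0(J; H^s) /\ C^1(J; H^(s-1)) with s > 3/2.  Each u t is the continuous
   representative of its class; since H^s(R) is then embedded in C^1(R), u_x is
   the classical derivative.  The equation is an equality of elements of
   H^(s-1), hence almost everywhere in x, for every t in J. *)
Definition is_solution (R : realType) (s : R) (J : set R) (u : R -> R -> R)
    : Prop :=
  [/\ forall t, J t -> continuous (u t),
      C0_Hs s J u &
      exists u_t : R -> R -> R, C1_Hs (s - 1) J u u_t /\
        forall t, J t -> {ae @lebesgue_measure R, forall x,
          u_t t x + u t x * derive1 (u t) x
          + derive1 (Lambda_inv2 (fun y => 3 / 2 * derive1 (u t) y ^+ 2)) x = 0}].

(* Main.v *)
(** On the open set where u vanishes the equation reduces to
    d_x Lambda^{-2} F = 0 with F = 3/2 u_x^2 >= 0.  Since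
    Lambda^{-2} F (x) = (e^{-x} A(x) + e^x B(x)) / 2, where A and B are the
    integrals of e^y F and e^{-y} F over ]-oo, x] and [x, +oo[, and A and B are
    constant where F = 0, the vanishing of the derivative at two points forces
    A = B = 0, hence F = 0 and u(t, .) = 0 at one time t.  All other times are
    reached by conservation of mass: the derivative of \int_{-n}^n u dx is the
    difference of the flux u^2 / 2 + Lambda^{-2} F between -n and n, which tends
    to 0 as n -> oo, uniformly on compact time intervals; so the mass is 0 at
    all times and, u having a sign, u = 0.

    The embeddings H^s in C^0 (s > 1/2) and in C^1 (s > 3/2), which turn the
    convergences in H^s and H^(s-1) into uniform ones, follow from the one-sided
    inversion formula
    f(x) = 2 (2 pi)^(-1/2) \int_0^oo (a cos(x xi) - b sin(x xi)) d xi.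
    It is obtained by pairing the truncated transforms with e^{-e xi}, whose
    cosine transform is the Poisson kernel, and letting e tend to 0.  Using
    xi >= 0 only avoids any discussion of the parity of a and b. *)

Require Import Defs.
From mathcomp Require Import all_boot all_order all_algebra.
From mathcomp Require Import all_classical all_reals all_analysis.
From mathcomp Require Import measurable_realfun lra ring.

Set Implicit Arguments.
Unset Strict Implicit.
Unset Printing Implicit Defensive.

Import Order.TTheory GRing.Theory Num.Theory.
Import numFieldNormedType.Exports.

Local Open Scope classical_set_scope.
Local Open Scope ring_scope.

(** * Integration *)

Section RealIntegrals.
Context d (T : measurableType d) (R : realType) (mu : {measure set T -> \bar R}).
Implicit Types (f g h : T -> R) (D : set T).

(** Two gaps in regularity shape the proof. In time, u is differentiable only with values in
    H^(s-1), and the equation holds only almost everywhere in x; the derivative [v t] need not be a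
    continuous function, whereas the sup bounds are proved for continuous ones. Since the H^(s-1)
    norm ignores null sets, [v t] is traded for the continuous [- dflux (u t)], and the difference
    quotients in time then converge uniformly in x ([quotient_sup]). Both uses of the equation, on
    the vanishing set and for the mass, start from there. In space, u(t, .) need not be integrable,
    so a mass over the whole line may be meaningless. Only integrals over [-n, n] are handled; as u
    has a sign, their smallness for large n is enough. The decay of u_x that the flux requires is
    drawn from uniform continuity, which avoids a Plancherel theorem for u_x. *)

Lemma integrable_fun_measurable D f :
  mu.-integrable D (EFin \o f) -> measurable_fun D f.
Proof. by move=> /measurable_int /measurable_EFinP. Qed.

Lemma le_integrable_real D f g : measurable D -> measurable_fun D f ->
  (forall x, D x -> `|f x| <= g x) -> mu.-integrable D (EFin \o g) ->
  mu.-integrable D (EFin \o f).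
Proof.
move=> mD mf fg ig; apply: le_integrable ig => //.
- exact/measurable_EFinP.
- by move=> x Dx /=; rewrite lee_fin (le_trans (fg x Dx)) ?ler_norm.
Qed.

Lemma integrableD_real D f g : measurable D ->
  mu.-integrable D (EFin \o f) -> mu.-integrable D (EFin \o g) ->
  mu.-integrable D (EFin \o (fun x => f x + g x)).
Proof. by move=> mD; exact: integrableD. Qed.

Lemma integrableB_real D f g : measurable D ->
  mu.-integrable D (EFin \o f) -> mu.-integrable D (EFin \o g) ->
  mu.-integrable D (EFin \o (fun x => f x - g x)).
Proof. by move=> mD; exact: integrableB. Qed.

Lemma integrableZ_real D k f : measurable D ->
  mu.-integrable D (EFin \o f) -> mu.-integrable D (EFin \o (fun x => k * f x)).
Proof. by move=> mD; exact: integrableZl. Qed.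

Lemma integrableM_bounded D f g M : measurable D ->
  mu.-integrable D (EFin \o f) -> measurable_fun D g ->
  (forall x, D x -> `|g x| <= M) ->
  mu.-integrable D (EFin \o (fun x => f x * g x)).
Proof.
move=> mD fi mg gM; apply: (@le_integrable_real _ _ (fun x => M * `|f x|)) => //.
- by apply: measurable_funM => //; exact: integrable_fun_measurable.
- by move=> x Dx; rewrite normrM mulrC ler_wpM2r ?gM.
- by apply: integrableZ_real => //; exact: integrable_norm.
Qed.

Lemma Rintegral_le_norm D f g : measurable D ->
  mu.-integrable D (EFin \o g) -> measurable_fun D f ->
  (forall x, D x -> `|f x| <= g x) ->
  `|\int[mu]_(x in D) f x| <= \int[mu]_(x in D) g x.
Proof.
move=> mD ig mf fg.
have fi : mu.-integrable D (EFin \o f) by exact: le_integrable_real ig.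
apply: (le_trans (le_normr_Rintegral mD fi)).
by apply: le_Rintegral => //; exact: integrable_norm.
Qed.

Lemma Rintegral_dominated_cvg D (f_ : nat -> T -> R) f g : measurable D ->
  (forall n, measurable_fun D (f_ n)) ->
  (forall x, D x -> f_ n x @[n --> \oo] --> f x) ->
  mu.-integrable D (EFin \o g) ->
  (forall n x, D x -> `|f_ n x| <= g x) ->
  mu.-integrable D (EFin \o f) /\
  \int[mu]_(x in D) f_ n x @[n --> \oo] --> \int[mu]_(x in D) f x.
Proof.
move=> mD mf_ f_f ig f_g.
have mf : measurable_fun D f by exact: measurable_fun_cvg f_f.
have [] := @dominated_convergence _ _ _ mu D mD (fun n => EFin \o f_ n)
  (EFin \o f) (EFin \o g).
- by move=> n; exact/measurable_EFinP.
- exact/measurable_EFinP.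
- by apply/nearW => x Dx; apply: cvg_EFin (f_f x Dx); apply: nearW.
- exact: ig.
- by apply/nearW => x n Dx /=; rewrite lee_fin; exact: f_g.
move=> fi _ h; split=> //.
apply: fine_cvg; move: h.
rewrite -(_ : (\int[mu]_(x in D) f x)%:E = (\int[mu]_(x in D) (f x)%:E)%E) ?fineK//;
  exact: integrable_fin_num.
Qed.

(** Dominated convergence for the truncations [f \_ (A n)], whose absolute values are at most |f|:
    at each point of [D] they are eventually equal to [f]. *)
Lemma Rintegral_exhaust D (A : nat -> set T) f : measurable D ->
  (forall n, measurable (A n)) -> (forall n, A n `<=` D) ->
  (forall x, D x -> \forall n \near \oo, A n x) ->
  mu.-integrable D (EFin \o f) ->
  \int[mu]_(x in A n) f x @[n --> \oo] --> \int[mu]_(x in D) f x.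
Proof.
move=> mD mA AD Ax fi.
have mf := integrable_fun_measurable fi.
have [] := @Rintegral_dominated_cvg D (fun n => f \_ (A n)) f (fun x => `|f x|) mD.
- move=> n; apply/(measurable_restrict f (mA n) mD).
  by rewrite setIidr//; exact: measurable_funS mf.
- move=> x Dx; apply: (@cvg_near_cst _ _ _ (fun n => (f \_ (A n)) x)).
  by near=> n; rewrite patchE mem_set//; near: n; exact: Ax.
- exact: integrable_norm.
- move=> n x Dx; rewrite patchE; case: ifPn => //= _; by rewrite normr0.
move=> _; under eq_fun do rewrite -Rintegral_mkcondr setIidr//.
by [].
Unshelve. all: by end_near. Qed.

Lemma integrable_restrictT D f : measurable D ->
  mu.-integrable D (EFin \o f) -> mu.-integrable setT (EFin \o (f \_ D)).
Proof. by move=> mD /(integrable_mkcond _ mD); rewrite restrict_EFin. Qed.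

Lemma integrable_setC_split A f : measurable A ->
  mu.-integrable A (EFin \o f) -> mu.-integrable (~` A) (EFin \o f) ->
  mu.-integrable setT (EFin \o f).
Proof.
move=> mA /(integrable_mkcond _ mA) iA.
move=> /(integrable_mkcond _ (measurableC mA)) iC.
apply: eq_integrable (integrableD measurableT iA iC) => // x _.
rewrite /= !patchE; have [xA|xA] := boolP (x \in A).
  by rewrite ifF ?adde0//; apply/negbTE; rewrite notin_setE/= => /(_ (set_mem xA)).
by rewrite ifT ?add0e// inE/=; move: xA; rewrite notin_setE.
Qed.

End RealIntegrals.

(** * Trigonometric integrals *)

Section TrigIntegral.
Context {R : realType}.
Local Notation mu := (@lebesgue_measure R).
Implicit Types (p q : R -> R) (D : set R) (x y z a b : R).

Lemma cos_lip a b : `|cos a - cos b| <= `|a - b|.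
Proof.
wlog ab : a b / a <= b.
  move=> h; have [/h//|/ltW/h] := leP a b.
  by rewrite distrC (distrC b).
have [c _] := @MVT_segment R cos (fun x => - sin x) a b ab
  (fun x _ => is_derive_cos x)
  (continuous_subspaceT (@continuous_cos R)).
move=> h; rewrite distrC h normrM (distrC a) ler_piMl// normrN.
by rewrite ler_norml sin_geN1 sin_le1.
Qed.

Lemma sin_lip a b : `|sin a - sin b| <= `|a - b|.
Proof.
wlog ab : a b / a <= b.
  move=> h; have [/h//|/ltW/h] := leP a b.
  by rewrite distrC (distrC b).
have [c _] := @MVT_segment R sin cos a b ab
  (fun x _ => is_derive_sin x)
  (continuous_subspaceT (@continuous_sin R)).
move=> h; rewrite distrC h normrM (distrC a) ler_piMl//.
by rewrite ler_norml cos_geN1 cos_le1.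
Qed.

Lemma measurable_cosM D z : measurable D -> measurable_fun D (fun xi : R => cos (z * xi)).
Proof.
move=> mD; apply: measurable_funTS; apply: continuous_measurable_fun => x.
apply: continuous_comp; [exact: mulrl_continuous|exact: continuous_cos].
Qed.

Lemma measurable_sinM D z : measurable D -> measurable_fun D (fun xi : R => sin (z * xi)).
Proof.
move=> mD; apply: measurable_funTS; apply: continuous_measurable_fun => x.
apply: continuous_comp; [exact: mulrl_continuous|exact: continuous_sin].
Qed.

(** The real part of \int_D (p - i q) e^{i z xi} d xi. Keeping both coefficients makes the family
    stable under d/dz and lets it express the truncated transforms as well as the inversion
    formula. *)
Definition trig_int D p q z :=
  \int[mu]_(xi in D) (p xi * cos (z * xi) + q xi * sin (z * xi)).

Lemma ler_norm_cos a : `|cos a| <= 1.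
Proof. by rewrite ler_norml cos_geN1 cos_le1. Qed.

Lemma ler_norm_sin a : `|sin a| <= 1.
Proof. by rewrite ler_norml sin_geN1 sin_le1. Qed.

Lemma integrable_trig D p q z : measurable D ->
  mu.-integrable D (EFin \o p) -> mu.-integrable D (EFin \o q) ->
  mu.-integrable D (EFin \o (fun xi => p xi * cos (z * xi) + q xi * sin (z * xi))).
Proof.
move=> mD ip iq; apply: integrableD_real => //.
- apply: (@integrableM_bounded _ _ _ mu _ _ _ 1) => //; first exact: measurable_cosM.
  by move=> x _; exact: ler_norm_cos.
- apply: (@integrableM_bounded _ _ _ mu _ _ _ 1) => //; first exact: measurable_sinM.
  by move=> x _; exact: ler_norm_sin.
Qed.

Lemma trig_int_bound D p q z : measurable D ->
  mu.-integrable D (EFin \o p) -> mu.-integrable D (EFin \o q) ->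
  `|trig_int D p q z| <= \int[mu]_(xi in D) (`|p xi| + `|q xi|).
Proof.
move=> mD ip iq; apply: Rintegral_le_norm => //.
- by apply: integrableD_real => //; exact: integrable_norm.
- by have /integrable_fun_measurable := integrable_trig z mD ip iq.
- move=> x _; apply: (le_trans (ler_normD _ _)); rewrite !normrM.
  by apply: lerD; rewrite ler_piMr// ?ler_norm_cos ?ler_norm_sin.
Qed.

(** Increments of cos and sin are at most min(2, |x - y| |xi|), so the integral changes by at most
    \int g min(2, |xi| / (n + 1)) once |x - y| <= 1 / (n + 1). The cap 2 supplies the integrable
    majorant 2 g, and dominated convergence makes this bound tend to 0. *)
Lemma trig_int_unif_cont D p q (e : R) : measurable D ->
  mu.-integrable D (EFin \o p) -> mu.-integrable D (EFin \o q) -> 0 < e ->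
  exists2 d : R, 0 < d & forall x y, `|x - y| <= d ->
    `|trig_int D p q x - trig_int D p q y| <= e.
Proof.
move=> mD ip iq e0.
pose g := fun xi => `|p xi| + `|q xi|.
have ig : mu.-integrable D (EFin \o g).
  by apply: integrableD_real => //; exact: integrable_norm.
have mg := integrable_fun_measurable ig.
pose m (n : nat) xi := g xi * Num.min 2 (`|xi| * n.+1%:R^-1).
have mm n : measurable_fun D (m n).
  apply: measurable_funM => //; apply: measurable_minr => //.
  by apply: measurable_funM => //; exact: normr_measurable.
have g0 xi : 0 <= g xi by rewrite addr_ge0.
have m0 n (xi : R) : 0 <= Num.min 2 (`|xi| * n.+1%:R^-1).
  by rewrite le_min ler0n/= mulr_ge0// invr_ge0.
have mle n xi : D xi -> `|m n xi| <= 2 * g xi.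
  move=> _; rewrite ger0_norm ?mulr_ge0// mulrC /m ler_wpM2l//.
  by rewrite ge_min lexx.
have mc xi : D xi -> m n xi @[n --> \oo] --> 0.
  move=> _; rewrite -(mulr0 (g xi)); apply: cvgMr.
  have h : `|xi| * n.+1%:R^-1 @[n --> \oo] --> (0 : R).
    by rewrite -(mulr0 `|xi|); apply: cvgMr; exact: cvg_harmonic.
  apply: (squeeze_cvgr _ (cvg_cst 0) h).
  by apply: nearW => n; rewrite m0/= ge_min lexx orbT.
have i2g := integrableZ_real (mu := mu) 2 mD ig.
have [_ ] := Rintegral_dominated_cvg (mu := mu) mD mm mc i2g mle.
rewrite Rintegral_cst// mul0r => /cvgr0_norm_le /(_ _ e0)[N _ hN].
exists N.+1%:R^-1; first by rewrite invr_gt0.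
move=> x y xy; rewrite /trig_int -RintegralB//; [|exact: integrable_trig..].
apply: (le_trans _ (le_trans (ler_norm _) (hN N (leqnn N)))).
have im : mu.-integrable D (EFin \o m N).
  by exact: (le_integrable_real (mu := mu) mD (mm N) (mle N) i2g).
apply: Rintegral_le_norm => //.
  by apply: integrable_fun_measurable; apply: integrableB_real => //; exact: integrable_trig.
move=> xi _.
have -> : p xi * cos (x * xi) + q xi * sin (x * xi) -
  (p xi * cos (y * xi) + q xi * sin (y * xi)) =
  p xi * (cos (x * xi) - cos (y * xi)) + q xi * (sin (x * xi) - sin (y * xi)) by ring.
have dxy : `|x * xi - y * xi| <= `|xi| * N.+1%:R^-1.
  by rewrite -mulrBl normrM mulrC ler_wpM2l.
apply: (le_trans (ler_normD _ _)); rewrite !normrM /m /g mulrDl.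
apply: lerD; apply: ler_wpM2l => //; rewrite le_min; apply/andP; split.
- by rewrite (le_trans (ler_normB _ _))// (_ : 2 = 1 + 1)// lerD// ler_norm_cos.
- exact: le_trans (cos_lip _ _) dxy.
- by rewrite (le_trans (ler_normB _ _))// (_ : 2 = 1 + 1)// lerD// ler_norm_sin.
- exact: le_trans (sin_lip _ _) dxy.
Qed.

Lemma is_derive_trig_int D p q z : measurable D ->
  mu.-integrable D (EFin \o p) -> mu.-integrable D (EFin \o q) ->
  mu.-integrable D (EFin \o (fun xi => xi * p xi)) ->
  mu.-integrable D (EFin \o (fun xi => xi * q xi)) ->
  is_derive z 1 (trig_int D p q)
    (trig_int D (fun xi => xi * q xi) (fun xi => - (xi * p xi)) z).
Proof.
move=> mD ip iq ixp ixq.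
pose f x xi := p xi * cos (x * xi) + q xi * sin (x * xi).
have df x xi : is_derive x (1 : R) (f ^~ xi)
    (xi * q xi * cos (x * xi) + - (xi * p xi) * sin (x * xi)).
  rewrite /f; apply: is_derive_eq.
  rewrite /GRing.scale/=; ring.
have Ef x xi : partial1of2 f x xi =
    xi * q xi * cos (x * xi) + - (xi * p xi) * sin (x * xi).
  by rewrite partial1of2E; have := df x xi; move=> h; rewrite derive_val.
have zI : `]z - 1, z + 1[%classic z by rewrite /= in_itv/= ltrBlDr ltrDl ltr01.
(* Independent of x, so it dominates the x-derivatives on the whole window around z. *)
pose G xi := `|xi * p xi| + `|xi * q xi|.
have iG : mu.-integrable D (EFin \o G).
  by apply: integrableD_real => //; exact: integrable_norm.
have intf x : `]z - 1, z + 1[%classic x -> mu.-integrable D (EFin \o f x).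
  by move=> _; exact: integrable_trig.
have derf x xi : `]z - 1, z + 1[%classic x -> D xi -> derivable (f ^~ xi) x 1.
  by move=> _ _; have [] := df x xi.
have G0 xi : 0 <= G xi by rewrite addr_ge0.
have fG x xi : `]z - 1, z + 1[%classic x -> D xi -> `|partial1of2 f x xi| <= G xi.
  move=> _ _; rewrite Ef (le_trans (ler_normD _ _))// /G (addrC `|xi * p xi|).
  rewrite (normrM (xi * q xi)) (normrM (- _)) normrN.
  by apply: lerD; rewrite ler_piMr// ?ler_norm_cos ?ler_norm_sin.
apply: DeriveDef.
- exact: (derivable_under_integral (mu := mu) mD zI intf derf G0 iG fG).
- rewrite -derive1E.
  rewrite (differentiation_under_integral (mu := mu) mD zI intf derf G0 iG fG).
  by apply: eq_Rintegral => xi _; rewrite Ef.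
Qed.

End TrigIntegral.

(** * Laplace and Poisson integrals *)

Section Calculus.
Context {R : realType}.
Local Notation mu := (@lebesgue_measure R).
Implicit Types (f g F : R -> R) (x y z a b c l e : R).

Lemma is_derive_continuous F x l : is_derive x 1 F l -> {for x, continuous F}.
Proof.
by move=> h; apply: differentiable_continuous; apply/derivable1_diffP; case: h.
Qed.

Lemma continuous_integrable_itv f a b : continuous f ->
  mu.-integrable `[a, b] (EFin \o f).
Proof.
move=> cf; apply: continuous_compact_integrable; first exact: segment_compact.
exact: continuous_subspaceT.
Qed.

Lemma Rintegral_FTC2 f F a b : a <= b -> continuous f ->
  (forall x, is_derive x (1 : R) F (f x)) ->
  \int[mu]_(x in `[a, b]) f x = F b - F a.
Proof.
rewrite le_eqVlt => /predU1P[<-|ab] cf dF.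
  by rewrite set_itv1 Rintegral_set1 subrr.
have cF : continuous F by move=> x; exact: is_derive_continuous (dF x).
rewrite /Rintegral (@continuous_FTC2 _ _ F)//.
- exact: continuous_subspaceT.
- split.
  + by move=> x _; have [] := dF x.
  + exact/cvg_at_right_filter/cF.
  + exact/cvg_at_left_filter/cF.
- by move=> x _; rewrite derive1E; have h := dF x; rewrite derive_val.
Qed.

(** For a non-negative integrand, a finite limit of the primitive already forces integrability. The
    margin [c < a] makes the hypotheses two-sided at the endpoint a, while still admitting powers of
    1 + x, which are smooth only on a half-line. *)
Lemma ge0_integrable_FTC2y f F c a l : c < a ->
  (forall x, c < x -> 0 <= f x) -> (forall x, c < x -> {for x, continuous f}) ->
  (forall x, c < x -> is_derive x 1 F (f x)) -> F x @[x --> +oo] --> l ->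
  mu.-integrable `[a, +oo[ (EFin \o f) /\
  \int[mu]_(x in `[a, +oo[) f x = l - F a.
Proof.
move=> ca f0 cf dF Fl.
have cfa : {within `[a, +oo[, continuous f}.
  apply: continuous_in_subspaceT => x; rewrite inE/= in_itv/= andbT => ax.
  by apply: cf; exact: lt_le_trans ax.
have fa0 x : a <= x -> 0 <= f x by move=> ax; apply: f0; exact: lt_le_trans ax.
have dFa x : a < x -> derivable F x 1 by move=> ax; have [] := dF x (lt_trans ca ax).
have E : (\int[mu]_(x in `[a, +oo[) (f x)%:E = l%:E - (F a)%:E)%E.
  apply: ge0_continuous_FTC2y => //.
  - by apply: cvg_at_right_filter; exact: is_derive_continuous (dF a ca).
  - move=> x; rewrite in_itv/= andbT => ax.
    by rewrite derive1E; have h := dF x (lt_trans ca ax); rewrite derive_val.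
split; last by rewrite /Rintegral E.
apply/integrableP; split.
  apply/measurable_EFinP; apply: subspace_continuous_measurable_fun => //.
have -> : (\int[mu]_(x in `[a, +oo[) `|(EFin \o f) x| =
    \int[mu]_(x in `[a, +oo[) (f x)%:E)%E.
  apply: eq_integral => x; rewrite inE/= in_itv/= andbT => ax.
  by rewrite /= ger0_norm// fa0.
by rewrite E ltry.
Qed.

Lemma cvgy_expNM e : 0 < e -> expR (- (e * x)) @[x --> +oo] --> (0 : R).
Proof.
move=> e0; apply: (@cvg_comp _ _ _ (fun x => e * x) (fun x => expR (- x)) +oo +oo).
  by apply: gt0_cvgMry => //; exact: cvg_id.
exact: cvgr_expR.
Qed.

Lemma integrable_expN e : 0 < e ->
  mu.-integrable `[0, +oo[ (EFin \o (fun x : R => expR (- (e * x)))).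
Proof.
move=> e0.
have [] // := @ge0_integrable_FTC2y (fun x => expR (- (e * x)))
  (fun x => - (expR (- (e * x)) / e)) (-1) 0 0.
- move=> x _; apply: is_derive_continuous.
- move=> x _; apply: is_derive_eq; rewrite /GRing.scale/=.
  by field; rewrite gt_eqF.
- rewrite -oppr0; apply: cvgN; rewrite -(mul0r e^-1); apply: cvgMl.
  exact: cvgy_expNM.
Qed.

(* Re of \int_0^oo e^{-(e - i y) xi} d xi = 1 / (e - i y). *)
Lemma Rintegral_expN_cos e y : 0 < e ->
  \int[mu]_(xi in `[0, +oo[) (expR (- (e * xi)) * cos (y * xi)) =
  e / (e ^+ 2 + y ^+ 2).
Proof.
move=> e0.
pose f xi := expR (- (e * xi)) * cos (y * xi).
(* The real part of e^{(- e + i y) xi} / (- e + i y), a primitive of [f]. *)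
pose H xi := expR (- (e * xi)) * (y * sin (y * xi) - e * cos (y * xi)) / (e ^+ 2 + y ^+ 2).
have N0 : e ^+ 2 + y ^+ 2 != 0 by rewrite gt_eqF// ltr_wpDr ?sqr_ge0 ?exprn_gt0.
have dH xi : is_derive xi (1 : R) H (f xi).
  rewrite /H; apply: is_derive_eq; rewrite /GRing.scale/= /f; field.
  exact: N0.
have cf : continuous f.
  by move=> x; apply: (@is_derive_continuous _ x).
have fi : mu.-integrable `[0, +oo[ (EFin \o f).
  apply: (@integrableM_bounded _ _ _ mu _ _ _ 1) => //; first exact: integrable_expN.
    exact: measurable_cosM.
  by move=> x _; exact: ler_norm_cos.
(* The integrand may change sign, so the half-line formula for non-negative functions does not
   apply; the integrals over [0, n] are given two limits, which must agree. *)
have h1 : \int[mu]_(xi in `[0, n%:R]) f xi @[n --> \oo] --> \int[mu]_(xi in `[0, +oo[) f xi.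
  apply: Rintegral_exhaust => //.
  - by move=> n; apply: subset_itvl.
  - move=> x /=; rewrite in_itv/= andbT => x0; near=> n; rewrite /= in_itv/= x0/=.
    near: n; exact: nbhs_infty_ger.
have h2 : \int[mu]_(xi in `[0, n%:R]) f xi @[n --> \oo] --> 0 - H 0.
  under eq_fun do rewrite (Rintegral_FTC2 (ler0n _ _) cf dH).
  apply: cvgB; last exact: cvg_cst.
  apply: norm_cvg0.
  have h0 : expR (- (e * n%:R)) * ((`|y| + e) / (e ^+ 2 + y ^+ 2)) @[n --> \oo] --> (0 : R).
    rewrite -(mul0r ((`|y| + e) / (e ^+ 2 + y ^+ 2))); apply: cvgMl.
    exact: (cvg_comp _ _ (@cvgr_idn R) (cvgy_expNM e0)).
  apply: (squeeze_cvgr _ (cvg_cst 0) h0).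
  apply: nearW => n; rewrite normr_ge0/= /H -mulrA normrM ger0_norm ?expR_ge0//.
  rewrite ler_wpM2l ?expR_ge0// normrM [X in _ * X <= _]gtr0_norm; last first.
    by rewrite invr_gt0 ltr_wpDr ?sqr_ge0 ?exprn_gt0.
  rewrite ler_wpM2r// ?invr_ge0 ?addr_ge0 ?sqr_ge0//.
  rewrite (le_trans (ler_normB _ _))// !normrM (gtr0_norm e0).
  by apply: lerD; rewrite ler_piMr// ?ler_norm_sin ?ler_norm_cos// ltW.
have := cvg_unique _ h1 h2.
move=> ->//.
by rewrite /H !mulr0 oppr0 expR0 sin0 cos0; field.
Unshelve. all: by end_near. Qed.

Lemma ge0_integrable_FTC2Ny f F b l :
  (forall x, 0 <= f x) -> continuous f ->
  (forall x, is_derive x 1 F (f x)) -> F x @[x --> -oo] --> l ->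
  mu.-integrable `]-oo, b] (EFin \o f) /\
  \int[mu]_(x in `]-oo, b]) f x = F b - l.
Proof.
move=> f0 cf dF Fl.
have cfN x : {for x, continuous (fun x => f (- x))}.
  by apply: continuous_comp; [exact: opp_continuous|exact: cf].
have dFN x : is_derive x (1 : R) (fun x => - F (- x)) (f (- x)).
  have h : is_derive x (1 : R) (F \o -%R) (f (- x) * -1).
    exact: is_derive1_comp (dF (- x)) _.
  have := is_deriveN h.
  by rewrite mulrN1 opprK.
have FNl : - F (- x) @[x --> +oo] --> - l.
  by apply: cvgN; move: Fl => /cvgNy_compNP.
have [] := @ge0_integrable_FTC2y (fun x => f (- x)) (fun x => - F (- x))
  (- b - 1) (- b) (- l) _ (fun x _ => f0 (- x)) (fun x _ => cfN x)
  (fun x _ => dFN x) FNl; first by rewrite ltrBlDr ltrDl ltr01.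
have E : (\int[mu]_(x in `]-oo, b]) (f x)%:E =
    \int[mu]_(x in `[(- b)%R, +oo[) (f (- x))%:E)%E.
  rewrite -[in LHS](opprK b) ge0_integration_by_substitutionNy//.
  exact: continuous_subspaceT.
move=> /integrableP[_ ioo] EN; split; last first.
  by rewrite /Rintegral E -/(Rintegral _ _ _) EN !opprK addrC.
apply/integrableP; split.
  by apply/measurable_EFinP/measurable_funTS; exact: continuous_measurable_fun.
have -> : (\int[mu]_(x in `]-oo, b]) `|(EFin \o f) x| =
    \int[mu]_(x in `]-oo, b]) (f x)%:E)%E.
  by apply: eq_integral => x _; rewrite /= ger0_norm.
rewrite E; move: ioo; congr (_ < _)%E.
by apply: eq_integral => x _; rewrite /= ger0_norm.
Qed.

Lemma setC_itvNyc b : ~` `]-oo, b]%classic = `]b, +oo[%classic :> set R.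
Proof. by rewrite setCitvl. Qed.

Lemma integrable_itv_split f z : measurable_fun setT f ->
  mu.-integrable `]-oo, z] (EFin \o f) -> mu.-integrable `[z, +oo[ (EFin \o f) ->
  mu.-integrable setT (EFin \o f) /\
  \int[mu]_x f x = \int[mu]_(x in `]-oo, z]) f x + \int[mu]_(x in `[z, +oo[) f x.
Proof.
move=> mf i1 i2.
have i3 : mu.-integrable `]z, +oo[ (EFin \o f).
  by apply: integrableS i2 => //; by apply: subset_itvr; rewrite bnd_simp.
have iT : mu.-integrable setT (EFin \o f).
  by apply: (@integrable_setC_split _ _ _ mu `]-oo, z]%classic) => //; rewrite setC_itvNyc.
split=> //.
have E : setT = `]-oo, z]%classic `|` `]z, +oo[%classic :> set R by rewrite -setC_itvNyc setUv.
rewrite E Rintegral_setU//; last 2 first.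
- by rewrite -E.
- by apply/disj_setPS; rewrite -setC_itvNyc setICr.
by rewrite Rintegral_itv_obnd_cbnd.
Qed.

Lemma poisson_kernel e z : 0 < e ->
  mu.-integrable setT (EFin \o (fun x => e / (e ^+ 2 + (x - z) ^+ 2))) /\
  \int[mu]_x (e / (e ^+ 2 + (x - z) ^+ 2)) = pi.
Proof.
move=> e0.
pose f x := e / (e ^+ 2 + (x - z) ^+ 2).
pose F x := atan ((x - z) / e).
have N0 x : e ^+ 2 + (x - z) ^+ 2 != 0 by rewrite gt_eqF// ltr_wpDr ?sqr_ge0 ?exprn_gt0.
have f0 x : 0 <= f x by rewrite divr_ge0 ?addr_ge0 ?sqr_ge0// ltW.
have dF x : is_derive x (1 : R) F (f x).
  have h : is_derive x (1 : R) (fun x => (x - z) / e) e^-1.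
    by apply: is_derive_eq; rewrite /GRing.scale/=; ring.
  have := @is_derive1_comp R (@atan R) (fun x => (x - z) / e) x _ _ (is_derive1_atan _) h.
  move=> /is_derive_eq; apply; rewrite /f; field.
  by rewrite N0 gt_eqF.
have cf : continuous f.
  move=> x; rewrite /f; apply: cvgM; first exact: cvg_cst.
  apply: cvgV => //; apply: cvgD; first exact: cvg_cst.
  by apply: (@is_derive_continuous (fun x => (x - z) ^+ 2)).
have atany w : atan ((x - w) / e) @[x --> +oo] --> pi / 2.
  apply: (@cvg_comp _ _ _ (fun x => (x - w) / e) (@atan R) +oo +oo); last exact: cvgy_atan.
  apply: gt0_cvgMly; first by rewrite invr_gt0.
  apply/cvgryPge => A; near=> x; rewrite lerBrDr; near: x.
  by apply: nbhs_pinfty_ge; exact: num_real.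
have FNy : F x @[x --> -oo] --> - (pi / 2).
  apply/cvgNy_compNP.
  rewrite (_ : F \o -%R = fun x => - atan ((x - - z) / e)); first exact: cvgN.
  by apply/funext => x; rewrite /F/= -atanN -mulNr opprD opprK.
have [i1 E1] := ge0_integrable_FTC2Ny z f0 cf dF FNy.
have [|i2 E2] := @ge0_integrable_FTC2y f F (z - 1) z (pi / 2) _
  (fun x _ => f0 x) (fun x _ => cf x) (fun x _ => dF x) (atany z).
  by rewrite ltrBlDr ltrDl ltr01.
have [|-> ->] := integrable_itv_split _ i1 i2; first exact: continuous_measurable_fun.
by rewrite E1 E2 opprK; split => //; field.
Unshelve. all: by end_near. Qed.

End Calculus.

(** * Square-integrable functions *)

Section L2Facts.
Context {R : realType}.
Local Notation mu := (@lebesgue_measure R).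
Implicit Types (f g : R -> R).

Lemma L2normE f : L2norm f = ((\int[mu]_x (f x ^+ 2)%:E) `^ 2^-1)%E.
Proof.
rewrite /L2norm unlock; congr (_ `^ _)%E; apply: eq_integral => x _.
by rewrite /= powR_mulrn// real_normK// num_real.
Qed.

Lemma L2P f : L2 f <-> measurable_fun setT f /\
  mu.-integrable setT (EFin \o (fun x => f x ^+ 2)).
Proof.
split=> [h|[mf fi]].
  split; last exact: Lfun2_integrable_sqr.
  by move: h; rewrite /L2 inE => /andP[/set_mem].
rewrite /L2 inE; apply/andP; split; rewrite inE//=.
rewrite /finite_norm -/(L2norm f) L2normE poweR_lty//.
have /integrableP[_] := fi; congr (_ < _)%E.
by apply: eq_integral => x _; rewrite /= ger0_norm// sqr_ge0.
Qed.

Lemma L2norm_hoelder f g (M N : R) :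
  measurable_fun setT f -> measurable_fun setT g ->
  (L2norm f <= M%:E)%E -> (L2norm g <= N%:E)%E ->
  mu.-integrable setT (EFin \o (fun x => f x * g x)) /\
  \int[mu]_x `|f x * g x| <= M * N.
Proof.
move=> mf mg fM gN.
have h : (\int[mu]_x `|(f x * g x)%:E| <= (M * N)%:E)%E.
  have h2 : 2^-1 + 2^-1 = 1 :> R by field.
  have := @hoelder _ _ _ mu f g 2 2 mf mg (ltr0Sn R 1) (ltr0Sn R 1) h2.
  rewrite Lnorm1 => /le_trans; apply.
  by rewrite EFinM; apply: lee_pmul => //; exact: Lnorm_ge0.
have i : mu.-integrable setT (EFin \o (fun x => f x * g x)).
  apply/integrableP; split; first exact/measurable_EFinP/measurable_funM.
  by apply: le_lt_trans h _; rewrite ltry.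
split=> //.
rewrite -lee_fin /Rintegral fineK//.
by apply: integrable_fin_num => //; exact: integrable_norm.
Qed.

Lemma L2M_integrable f g : L2 f -> L2 g ->
  mu.-integrable setT (EFin \o (fun x => f x * g x)).
Proof.
by move=> hf hg; apply/Lfun1_integrable; exact: Lfun2_mul_Lfun1.
Qed.

(** On a bounded interval the majorant 1 + f^2 is integrable, and |f| <= 1 + f^2 follows from (|f| -
    1)^2 >= 0. *)
Lemma L2_integrable_itv f a b : L2 f -> mu.-integrable `[a, b] (EFin \o f).
Proof.
move=> /L2P[mf f2].
apply: (@le_integrable_real _ _ _ mu _ _ (fun x => 1 + f x ^+ 2)) => //.
- exact: measurable_funTS.
- move=> x _; have := sqr_ge0 (`|f x| - 1); rewrite sqrrB real_normK ?num_real//.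
  have := sqr_ge0 (f x); have := normr_ge0 (f x); lra.
- apply: integrableD_real => //; first by apply: continuous_integrable_itv => x; exact: cvg_cst.
  exact: integrableS f2.
Qed.

(** As |k| <= 1, the function f(x) g(y) k(x, y) is dominated by |f(x)| |g(y)|, whose iterated
    integral is a product of two finite ones. It serves with k(x, xi) = cos((x - z) xi). *)
Lemma Rintegral_Fubini_bounded (f g : R -> R) (k : R * R -> R) :
  mu.-integrable setT (EFin \o f) -> mu.-integrable setT (EFin \o g) ->
  measurable_fun setT k -> (forall z, `|k z| <= 1) ->
  \int[mu]_x (f x * \int[mu]_y (g y * k (x, y))) =
  \int[mu]_y (g y * \int[mu]_x (f x * k (x, y))).
Proof.
move=> fi gi mk k1.
have mf := integrable_fun_measurable fi.
have mg := integrable_fun_measurable gi.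
pose F (z : R * R) := f z.1 * g z.2 * k z.
have mF : measurable_fun setT F.
  apply: measurable_funM => //; apply: measurable_funM.
    by apply: measurableT_comp => //; exact: measurable_fst.
  by apply: measurableT_comp => //; exact: measurable_snd.
have iF : (mu \x mu)%E.-integrable setT (EFin \o F).
  apply/integrable12ltyP; first exact/measurable_EFinP.
  pose C := \int[mu]_y `|g y|.
  have iC : mu.-integrable setT (EFin \o (fun y => `|g y|)) by exact: integrable_norm.
  have EC : (\int[mu]_y `|g y|%:E)%E = C%:E.
    by rewrite /C /Rintegral fineK//; exact: integrable_fin_num.
  apply: (@le_lt_trans _ _ (\int[mu]_x (C * `|f x|)%:E)%E); last first.
    have /(integrableZ_real C measurableT) := integrable_norm fi.
    by move/integrable_lty; apply.
  apply: ge0_le_integral => //.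
  - by move=> x _; apply: integral_ge0.
  - apply: (@measurable_fun_fubini_tonelli_F _ _ _ _ _ mu (fun z => `|(F z)%:E|%E)).
      by apply: measurableT_comp => //; exact/measurable_EFinP.
    by move=> z; exact: abse_ge0.
  - by apply/measurable_EFinP; apply: measurable_funM => //; exact: measurableT_comp.
  - move=> x _; rewrite mulrC EFinM -EC -ge0_integralZl//; last first.
      by apply/measurable_EFinP; exact: measurableT_comp.
    apply: ge0_le_integral => //.
    + have mFx : measurable_fun setT (fun y => F (x, y)) :=
        measurableT_comp mF (measurable_pair1 x).
      rewrite (_ : (fun y => _) = EFin \o (fun y => `|F (x, y)|))//.
      by apply/measurable_EFinP; exact: measurableT_comp.
    + apply: measurable_funeM; apply/measurable_EFinP; exact: measurableT_comp.
    + by move=> y _; rewrite /F /= lee_fin !normrM ler_piMr// mulr_ge0.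
have igk x : mu.-integrable setT (EFin \o (fun y => g y * k (x, y))).
  apply: (@integrableM_bounded _ _ _ mu _ _ _ 1) => //.
  exact: (measurableT_comp mk (measurable_pair1 x)).
have ifk y : mu.-integrable setT (EFin \o (fun x => f x * k (x, y))).
  apply: (@integrableM_bounded _ _ _ mu _ _ _ 1) => //.
  exact: (measurableT_comp mk (measurable_pair2 y)).
have := Fubini iF; rewrite /Rintegral => E.
transitivity (fine (\int[mu]_x \int[mu]_y (EFin \o F) (x, y))%E).
  congr fine; apply: eq_integral => x _.
  rewrite EFinM fineK; last by apply: integrable_fin_num => //; exact: igk.
  rewrite -integralZl//; last exact: igk.
  apply: eq_integral => y _.
  by rewrite /F/= -EFinM mulrA.
rewrite E; congr fine; apply: eq_integral => y _.
rewrite EFinM fineK; last by apply: integrable_fin_num => //; exact: ifk.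
rewrite -integralZl//; last exact: ifk.
apply: eq_integral => x _.
by rewrite /F/= -EFinM; congr EFin; ring.
Qed.

End L2Facts.

(** * Fourier inversion *)

Section FourierInversion.
Context {R : realType}.
Local Notation mu := (@lebesgue_measure R).
Implicit Types (f g a b : R -> R) (z e xi : R) (n : nat).

Local Notation c := ((Num.sqrt (2 * pi : R))^-1).

Lemma fourier_trunc_reE f n xi :
  fourier_trunc_re f n xi = c * trig_int `[- n%:R, n%:R] f (fun=> 0) xi.
Proof.
rewrite /fourier_trunc_re /trig_int; congr (_ * _).
by apply: eq_Rintegral => x _; rewrite mul0r addr0 (mulrC x).
Qed.

Lemma fourier_trunc_imE f n xi :
  fourier_trunc_im f n xi = - (c * trig_int `[- n%:R, n%:R] (fun=> 0) f xi).
Proof.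
rewrite /fourier_trunc_im /trig_int; congr (- (_ * _)).
by apply: eq_Rintegral => x _; rewrite mul0r add0r (mulrC x).
Qed.

Lemma continuous_trig_int D (p q : R -> R) : measurable D ->
  mu.-integrable D (EFin \o p) -> mu.-integrable D (EFin \o q) ->
  continuous (trig_int D p q).
Proof.
move=> mD ip iq x; apply/cvgrPdist_le => e e0.
have [d d0 h] := trig_int_unif_cont mD ip iq e0.
near=> y; apply: h; near: y; apply: cvgr_dist_le => //; exact: cvg_id.
Unshelve. all: by end_near. Qed.

Lemma measurable_fourier_trunc f n : L2 f ->
  measurable_fun setT (fourier_trunc_re f n) /\
  measurable_fun setT (fourier_trunc_im f n).
Proof.
move=> Lf; have fi : mu.-integrable `[- n%:R, n%:R] (EFin \o f) by exact: L2_integrable_itv.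
have i0 : mu.-integrable `[- n%:R, n%:R] (EFin \o (fun=> 0 : R)) by exact: integrable0.
rewrite (funext (fourier_trunc_reE f n)) (funext (fourier_trunc_imE f n)).
split; apply: continuous_measurable_fun => x.
- apply: cvgMr; exact: continuous_trig_int.
- apply: cvgN; apply: cvgMr; exact: continuous_trig_int.
Qed.

(** By the addition formula the bracket equals c \int f(x) cos((x - z) xi) dx, which centres the
    resulting kernel at z. The damping factor makes the xi-integral absolutely convergent, as Fubini
    requires. *)
Lemma fourier_trunc_inverse f n z e : L2 f -> 0 < e ->
  \int[mu]_(xi in `[0, +oo[) (expR (- (e * xi)) *
     (fourier_trunc_re f n xi * cos (z * xi) - fourier_trunc_im f n xi * sin (z * xi))) =
  c * \int[mu]_(x in `[- n%:R, n%:R]) (f x * (e / (e ^+ 2 + (x - z) ^+ 2))).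
Proof.
move=> Lf e0; set D := `[- n%:R, n%:R]%classic.
have fi : mu.-integrable D (EFin \o f) by exact: L2_integrable_itv.
have i0 : mu.-integrable D (EFin \o (fun=> 0 : R)) by exact: integrable0.
have c0 : c != 0.
  by rewrite invr_eq0 sqrtr_eq0 -ltNge mulr_gt0// pi_gt0.
have mD : measurable D by exact: measurable_itv.
pose f1 := f \_ D.
pose g := (fun xi => expR (- (e * xi))) \_ `[0, +oo[.
pose k (p : R * R) := cos ((p.1 - z) * p.2).
have E1 xi : fourier_trunc_re f n xi * cos (z * xi) - fourier_trunc_im f n xi * sin (z * xi)
    = c * \int[mu]_x (f1 x * k (x, xi)).
  rewrite fourier_trunc_reE fourier_trunc_imE mulNr opprK -!mulrA -mulrDr; congr (_ * _).
  rewrite /trig_int -!RintegralZr//; [|exact: integrable_trig..].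
  rewrite -RintegralD//; last 2 first.
  - by apply: (@integrableM_bounded _ _ _ mu _ _ (cst (cos (z * xi))) 1) => //;
      [exact: integrable_trig|move=> x _; exact: ler_norm_cos].
  - by apply: (@integrableM_bounded _ _ _ mu _ _ (cst (sin (z * xi))) 1) => //;
      [exact: integrable_trig|move=> x _; exact: ler_norm_sin].
  rewrite Rintegral_mkcond; apply: eq_Rintegral => x _.
  rewrite /f1 !patchE; case: ifPn => _; last by rewrite mul0r.
  by rewrite /k/= mulrBl cosB !(mulrC xi); ring.
have iF : mu.-integrable setT (EFin \o f1).
  exact: integrable_restrictT.
have iG : mu.-integrable setT (EFin \o g).
  by apply: integrable_restrictT => //; exact: integrable_expN.
have mk : measurable_fun setT k.
  apply: measurableT_comp; first by apply: continuous_measurable_fun; exact: continuous_cos.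
  apply: measurable_funM; last exact: measurable_snd.
  by apply: measurable_funB => //; exact: measurable_fst.
have k1 p : `|k p| <= 1 by exact: ler_norm_cos.
transitivity (\int[mu]_xi (g xi * (c * \int[mu]_x (f1 x * k (x, xi))))).
  rewrite Rintegral_mkcond; apply: eq_Rintegral => xi _.
  by rewrite /g !patchE; case: ifPn => _; rewrite ?mul0r// E1.
transitivity (\int[mu]_xi (c * (g xi * \int[mu]_x (f1 x * k (x, xi))))).
  by apply: eq_Rintegral => xi _; rewrite mulrCA.
rewrite RintegralZl//; last first.
  apply: (@integrableM_bounded _ _ _ mu _ _ _ (\int[mu]_x `|f1 x|)) => //.
  (* Measurability in xi of the inner integral is read off from [E1], as [c] is non-zero. *)
  - rewrite (_ : (fun xi => _) = fun xi => c^-1 *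
        (fourier_trunc_re f n xi * cos (z * xi) - fourier_trunc_im f n xi * sin (z * xi))); last first.
      by apply/funext => xi; rewrite E1 mulKf.
    have [m1 m2] := measurable_fourier_trunc n Lf.
    apply: measurable_funM => //; apply: measurable_funB; apply: measurable_funM => //.
      exact: measurable_cosM.
    exact: measurable_sinM.
  - move=> xi _; apply: Rintegral_le_norm => //; first exact: integrable_norm.
    + apply: measurable_funM; first exact: integrable_fun_measurable iF.
      exact: (measurableT_comp mk (measurable_pair2 xi)).
    + by move=> x _; rewrite normrM ler_piMr.
congr (_ * _).
rewrite -(Rintegral_Fubini_bounded iF iG mk k1) [RHS]Rintegral_mkcond.
apply: eq_Rintegral => x _; rewrite /f1 !patchE; case: ifPn => _; last by rewrite mul0r.
congr (_ * _); rewrite -(Rintegral_expN_cos _ e0) [RHS]Rintegral_mkcond.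
apply: eq_Rintegral => xi _; rewrite /g !patchE; case: ifPn => _; last by rewrite mul0r.
by [].
Qed.

Lemma L2norm_cvg0_pairing (h : nat -> R -> R) (p : R -> R) :
  (forall n, measurable_fun setT (h n)) -> L2 p ->
  L2norm (h n) @[n --> \oo] --> 0%E ->
  \int[mu]_x (h n x * p x) @[n --> \oo] --> (0 : R).
Proof.
move=> mh Lp h0.
have /L2P[mp ip] := Lp.
have pfin : L2norm p \is a fin_num.
  rewrite ge0_fin_numE ?Lnorm_ge0//.
  by move: Lp; rewrite /L2 inE => /andP[_ /set_mem].
(* The [+ 1] keeps [K] positive when [p] vanishes almost everywhere. *)
pose K := fine (L2norm p) + 1.
have K0 : 0 < K by rewrite ltr_wpDl// fine_ge0// Lnorm_ge0.
have pK : (L2norm p <= K%:E)%E by rewrite -[X in (X <= _)%E]fineK// lee_fin lerDl.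
apply/cvgr0Pnorm_le => e e0.
have eK : 0 < e / K by rewrite divr_gt0.
have : \forall n \near \oo, (L2norm (h n) <= (e / K)%:E)%E.
  have /fine_cvgP[hfin] := h0; move=> /cvgr0_norm_le /(_ _ eK) hle.
  near=> n; have f : L2norm (h n) \is a fin_num by near: n.
  rewrite -(fineK f) lee_fin (le_trans (ler_norm _))//.
  by near: n.
apply: filterS => n hn.
have [i hi] := L2norm_hoelder (mh n) mp hn pK.
rewrite divfK ?gt_eqF// in hi.
exact: le_trans (le_normr_Rintegral measurableT i) hi.
Unshelve. all: by end_near. Qed.

Lemma L2_le f g : measurable_fun setT f -> (forall x, `|f x| <= `|g x|) -> L2 g -> L2 f.
Proof.
move=> mf fg /L2P[mg ig]; apply/L2P; split=> //.
apply: (@le_integrable_real _ _ _ mu _ _ (fun x => g x ^+ 2)) => //.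
  exact: measurable_funX.
by move=> x _; rewrite normrX -[leRHS]real_normK ?num_real// lerXn2r ?nnegrE.
Qed.

Lemma L2_bounded_integrable f (M : R) : mu.-integrable setT (EFin \o f) ->
  (forall x, `|f x| <= M) -> L2 f.
Proof.
move=> fi fM; have mf := integrable_fun_measurable fi; apply/L2P; split => //.
have := @integrableM_bounded _ _ _ mu _ _ _ M measurableT fi mf (fun x _ => fM x).
by under eq_fun do rewrite -expr2.
Qed.

Lemma L2_poisson_kernel z e : 0 < e ->
  L2 (fun x => e / (e ^+ 2 + (x - z) ^+ 2)).
Proof.
move=> e0; have [iP _] := poisson_kernel z e0.
apply: (L2_bounded_integrable (M := e^-1) iP) => x.
have h : 0 < e ^+ 2 + (x - z) ^+ 2 by rewrite ltr_wpDr ?sqr_ge0 ?exprn_gt0.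
rewrite /= ger0_norm; last by rewrite divr_ge0// ltW.
rewrite ler_pdivrMr// -ler_pdivrMl ?invr_gt0// invrK.
by rewrite -expr2 lerDl sqr_ge0.
Qed.

(** The limit n -> oo in [fourier_trunc_inverse]. On the frequency side, the damped cosine and sine
    are square integrable, so L^2 convergence of the truncated transforms is enough; on the space
    side, f times the Poisson kernel is integrable because both factors are in L^2. *)
Lemma fourier_poisson f a b z e : is_fourier f a b -> 0 < e ->
  \int[mu]_(xi in `[0, +oo[) (expR (- (e * xi)) *
     (a xi * cos (z * xi) - b xi * sin (z * xi))) =
  c * \int[mu]_x (f x * (e / (e ^+ 2 + (x - z) ^+ 2))).
Proof.
move=> [Lf La Lb ca cb] e0.
have [ma _] := (L2P _).1 La; have [mb _] := (L2P _).1 Lb.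
pose g := (fun xi => expR (- (e * xi))) \_ `[0, +oo[.
have iG : mu.-integrable setT (EFin \o g).
  by apply: integrable_restrictT => //; exact: integrable_expN.
have g1 xi : `|g xi| <= 1.
  rewrite /g patchE; case: ifPn => [|_]; last by rewrite normr0.
  rewrite inE/= in_itv/= andbT => xi0; rewrite ger0_norm ?expR_ge0//.
  by rewrite -expR0 ler_expR oppr_le0 mulr_ge0// ltW.
have Lg : L2 g by exact: L2_bounded_integrable g1.
have mg := integrable_fun_measurable iG.
pose p1 xi := g xi * cos (z * xi).
pose p2 xi := g xi * sin (z * xi).
have Lp1 : L2 p1.
  apply: L2_le Lg; first by apply: measurable_funM => //; exact: measurable_cosM.
  by move=> x; rewrite normrM ler_piMr// ler_norm_cos.
have Lp2 : L2 p2.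
  apply: L2_le Lg; first by apply: measurable_funM => //; exact: measurable_sinM.
  by move=> x; rewrite normrM ler_piMr// ler_norm_sin.
pose A n := fourier_trunc_re f n; pose B n := fourier_trunc_im f n.
have mA n : measurable_fun setT (A n) by have [] := measurable_fourier_trunc n Lf.
have mB n : measurable_fun setT (B n) by have [] := measurable_fourier_trunc n Lf.
have fi n : mu.-integrable `[- n%:R, n%:R] (EFin \o f) by exact: L2_integrable_itv.
have i0 n : mu.-integrable `[- n%:R, n%:R] (EFin \o (fun=> 0 : R)) by exact: integrable0.
(* The two terms are integrable for different reasons: [A n] is bounded and [p1] integrable, while
   [a] and [p1] are both in L^2. *)
have iA n : mu.-integrable setT (EFin \o (fun xi => (A n xi - a xi) * p1 xi)).
  under eq_fun do rewrite mulrBl; apply: integrableB_real => //; last exact: L2M_integrable.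
  under eq_fun do rewrite mulrC.
  have ip : mu.-integrable setT (EFin \o p1).
    by apply: (@integrableM_bounded _ _ _ mu _ _ _ 1) => //;
      [exact: measurable_cosM|move=> x _; exact: ler_norm_cos].
  apply: (integrableM_bounded (mu := mu)
    (M := `|c| * \int[mu]_(x in `[- n%:R, n%:R]) (`|f x| + `|0 : R|))
    measurableT ip (mA n)) => x _.
  rewrite /A fourier_trunc_reE normrM ler_wpM2l//.
  exact: (trig_int_bound x (measurable_itv _) (fi n) (i0 n)).
have iB n : mu.-integrable setT (EFin \o (fun xi => (B n xi - b xi) * p2 xi)).
  under eq_fun do rewrite mulrBl; apply: integrableB_real => //; last exact: L2M_integrable.
  under eq_fun do rewrite mulrC.
  have ip : mu.-integrable setT (EFin \o p2).
    by apply: (@integrableM_bounded _ _ _ mu _ _ _ 1) => //;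
      [exact: measurable_sinM|move=> x _; exact: ler_norm_sin].
  apply: (integrableM_bounded (mu := mu)
    (M := `|c| * \int[mu]_(x in `[- n%:R, n%:R]) (`|0 : R| + `|f x|))
    measurableT ip (mB n)) => x _.
  rewrite /B fourier_trunc_imE normrN normrM ler_wpM2l//.
  exact: (trig_int_bound x (measurable_itv _) (i0 n) (fi n)).
have h1 := L2norm_cvg0_pairing (fun n => measurable_funB (mA n) ma) Lp1 ca.
have h2 := L2norm_cvg0_pairing (fun n => measurable_funB (mB n) mb) Lp2 cb.
have iap := L2M_integrable La Lp1.
have ibp := L2M_integrable Lb Lp2.
pose L := \int[mu]_xi (a xi * p1 xi - b xi * p2 xi).
have h3 : L + (\int[mu]_x ((A n x - a x) * p1 x) - \int[mu]_x ((B n x - b x) * p2 x))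
   @[n --> \oo] --> L + (0 - 0).
  by apply: cvgD; [exact: cvg_cst|exact: cvgB].
rewrite subr0 addr0 in h3.
pose P x := e / (e ^+ 2 + (x - z) ^+ 2).
have ifP : mu.-integrable setT (EFin \o (fun x => f x * P x)).
  by apply: L2M_integrable => //; exact: L2_poisson_kernel.
have h4 : c * \int[mu]_(x in `[- n%:R, n%:R]) (f x * P x) @[n --> \oo] -->
    c * \int[mu]_x (f x * P x).
  apply: cvgMr; apply: Rintegral_exhaust => //.
  move=> x _; near=> n; rewrite /= in_itv/= -ler_norml.
  near: n; exact: nbhs_infty_ger.
have h5 n : L + (\int[mu]_x ((A n x - a x) * p1 x) - \int[mu]_x ((B n x - b x) * p2 x)) =
   c * \int[mu]_(x in `[- n%:R, n%:R]) (f x * P x).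
  rewrite -(fourier_trunc_inverse _ _ Lf e0) [RHS]Rintegral_mkcond /L.
  rewrite -RintegralB// -RintegralD//; last 2 first.
  - exact: integrableB_real.
  - exact: integrableB_real.
  apply: eq_Rintegral => xi _.
  (* Outside its set a restriction takes the default value [point], which is 0 in [R]. *)
  rewrite /p1 /p2 /g !patchE; case: ifPn => _; rewrite /A /B -?[point]/(0 : R); ring.
rewrite (funext h5) in h3.
have <- : L = c * \int[mu]_x (f x * P x) by exact: (cvg_unique _ h3 h4).
rewrite Rintegral_mkcond; apply: eq_Rintegral => xi _.
rewrite /p1 /p2 /g !patchE; case: ifPn => _; rewrite -?[point]/(0 : R); ring.
Unshelve. all: by end_near. Qed.

(** Here [f] may be unbounded away from z. Within distance d of z continuity controls the integrand;
    beyond, the kernel of width h is at most h K times that of width 1, and the fixed integrable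
    function [H] bounds |f - f z| times the latter. *)
Lemma poisson_kernel_approx f z : L2 f -> {for z, continuous f} ->
  \int[mu]_x (f x * (n.+1%:R^-1 / (n.+1%:R^-1 ^+ 2 + (x - z) ^+ 2))) @[n --> \oo] -->
  pi * f z.
Proof.
move=> Lf cf.
pose P e x := e / (e ^+ 2 + (x - z) ^+ 2).
have [iP1 _] := poisson_kernel z (@ltr01 R).
have P0 e x : 0 < e -> 0 <= P e x.
  by move=> e0; rewrite divr_ge0 ?addr_ge0 ?sqr_ge0// ltW.
have LP e : 0 < e -> L2 (P e) by exact: L2_poisson_kernel.
pose H x := `|f x * P 1 x| + `|f z| * P 1 x.
have iH : mu.-integrable setT (EFin \o H).
  apply: integrableD_real => //; last exact: integrableZ_real.
  by apply: integrable_norm; apply: L2M_integrable => //; exact: LP.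
have H0 x : 0 <= H x by rewrite addr_ge0// mulr_ge0// P0.
have pi0 := pi_gt0 R.
apply/cvgrPdist_le => e e0.
(* Chosen so that [eta] times the total mass pi of the kernel is e / 2. *)
pose eta := e / 2 / pi.
have eta0 : 0 < eta by rewrite !divr_gt0.
have [d /= d0 hd] : exists2 d : R, 0 < d & forall x, `|x - z| <= d -> `|f x - f z| <= eta.
  have /cvgrPdist_le /(_ _ eta0) [d /= d0 hd] := cf.
  exists (d / 2); first by rewrite divr_gt0.
  move=> x xd; rewrite distrC; apply: hd => /=; rewrite distrC.
  by rewrite (le_lt_trans xd)// ltr_pdivrMr// ltr_pMr// ltr1n.
(* For |x - z| > d this gives 1 + (x - z)^2 <= K (x - z)^2. *)
pose K := 1 + d ^- 2.
have K0 : 0 < K by rewrite addr_gt0// invr_gt0 exprn_gt0.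
have est h x : 0 < h -> `|(f x - f z) * P h x| <= eta * P h x + h * K * H x.
  move=> h0; rewrite normrM (ger0_norm (P0 h x h0)).
  have [xz|xz] := leP `|x - z| d.
    rewrite ler_wpDr//; last by rewrite ler_wpM2r ?P0// hd.
    by rewrite mulr_ge0// mulr_ge0// ltW.
  rewrite ler_wpDl//; first by rewrite mulr_ge0 ?P0// (ltW eta0).
  have PK : P h x <= h * K * P 1 x.
    rewrite /P -!mulrA ler_wpM2l ?(ltW h0)// expr1n mul1r.
    have xz0 : 0 < (x - z) ^+ 2.
      by rewrite -real_normK ?num_real// exprn_gt0// (lt_trans d0).
    have s1 : 0 < 1 + (x - z) ^+ 2 by rewrite addr_gt0.
    have s2 : 0 < h ^+ 2 + (x - z) ^+ 2 by rewrite addr_gt0// exprn_gt0.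
    rewrite ler_pdivlMr// ler_pdivrMl//.
    have dx : d ^+ 2 <= (x - z) ^+ 2.
      by rewrite -[leRHS]real_normK ?num_real// lerXn2r ?nnegrE// ltW.
    have d2 : 0 < d ^+ 2 by rewrite exprn_gt0.
    apply: (@le_trans _ _ ((x - z) ^+ 2 * K)); last first.
      by rewrite ler_wpM2r ?(ltW K0)// lerDr sqr_ge0.
    rewrite /K mulrDr mulr1 addrC lerD2l.
    by rewrite ler_pdivlMr// mul1r.
  rewrite /H normrM (ger0_norm (P0 1 x ltr01)) -mulrDl [leRHS]mulrCA.
  by apply: ler_pM => //; [exact: P0|exact: ler_normB].
have lim0 : \forall n \near \oo, n.+1%:R^-1 * (K * \int[mu]_x H x) <= e / 2.
  have l0 : n.+1%:R^-1 * (K * \int[mu]_x H x) @[n --> \oo] --> (0 : R).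
    by rewrite -(mul0r (K * \int[mu]_x H x)); apply: cvgMl; exact: cvg_harmonic.
  have e20 : 0 < e / 2 by rewrite divr_gt0.
  by move/cvgr0_norm_le : l0 => /(_ _ e20); apply: filterS => n; exact: le_trans (ler_norm _).
near=> n.
have hn : n.+1%:R^-1 * (K * \int[mu]_x H x) <= e / 2 by near: n.
move: hn; set h := n.+1%:R^-1 : R => hn.
have h0 : 0 < h by rewrite invr_gt0.
have [iP EP0] := poisson_kernel z h0.
have EP : \int[mu]_x P h x = pi by exact: EP0.
have ifP : mu.-integrable setT (EFin \o (fun x => f x * P h x)).
  by apply: L2M_integrable => //; exact: LP.
have -> : pi * f z = \int[mu]_x (f z * P h x) by rewrite RintegralZl// EP mulrC.
rewrite distrC -RintegralB//; last exact: integrableZ_real.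
under eq_Rintegral do rewrite -mulrBl.
have iR : mu.-integrable setT (EFin \o (fun x => eta * P h x + h * K * H x)).
  by apply: integrableD_real => //; exact: integrableZ_real.
apply: (le_trans (Rintegral_le_norm measurableT iR _ (fun x _ => est h x h0))).
  have /integrable_fun_measurable mf := ifP; have /integrable_fun_measurable mP := iP.
  apply: measurable_funM => //; apply: measurable_funB => //.
  by have [] := (L2P _).1 Lf.
rewrite RintegralD//; [|exact: integrableZ_real..].
rewrite (@RintegralZl _ _ _ mu setT (P h) eta)//.
rewrite (@RintegralZl _ _ _ mu setT H (h * K))// EP /eta divfK ?gt_eqF//.
by rewrite [leRHS](splitr e) lerD2l -mulrA.
Unshelve. all: by end_near. Qed.

(** With a and b integrable the damping is removed by dominated convergence, while the Poisson
    integral tends to pi f(z). The factor 2 c inverts c pi, because c^2 = 1 / (2 pi). *)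
Lemma fourier_inversion f a b z : is_fourier f a b -> {for z, continuous f} ->
  mu.-integrable `[0, +oo[ (EFin \o a) -> mu.-integrable `[0, +oo[ (EFin \o b) ->
  f z = 2 * c * trig_int `[0, +oo[ a (fun xi => - b xi) z.
Proof.
move=> fab cf ia ib; have [Lf _ _ _ _] := fab.
have pi0 := pi_gt0 R.
have h1 := poisson_kernel_approx Lf cf.
have h2 : \int[mu]_(xi in `[0, +oo[) (expR (- (n.+1%:R^-1 * xi)) *
     (a xi * cos (z * xi) - b xi * sin (z * xi))) @[n --> \oo] -->
   trig_int `[0, +oo[ a (fun xi => - b xi) z.
  have ig : mu.-integrable `[0, +oo[ (EFin \o (fun xi => `|a xi| + `|b xi|)).
    by apply: integrableD_real => //; exact: integrable_norm.
  have ma := integrable_fun_measurable ia; have mb := integrable_fun_measurable ib.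
  have [//|||||] := @Rintegral_dominated_cvg _ _ _ mu `[0, +oo[%classic
    (fun n xi => expR (- (n.+1%:R^-1 * xi)) * (a xi * cos (z * xi) - b xi * sin (z * xi)))
    (fun xi => a xi * cos (z * xi) + (- b xi) * sin (z * xi)) (fun xi => `|a xi| + `|b xi|).
  - move=> n; apply: measurable_funM.
      apply: measurable_funTS; apply: continuous_measurable_fun => x.
      by apply: is_derive_continuous.
    apply: measurable_funB; apply: measurable_funM => //.
      exact: measurable_cosM.
    exact: measurable_sinM.
  - move=> xi _; rewrite -[X in _ --> X]mul1r mulNr; apply: cvgMl.
    rewrite -[X in _ --> X]expR0 -oppr0.
    apply: (@cvg_comp _ _ _ (fun n => - (n.+1%:R^-1 * xi)) (@expR R) \oo (nbhs (- 0)));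
      last exact: continuous_expR.
    by apply: cvgN; rewrite -(mul0r xi); apply: cvgMl; exact: cvg_harmonic.
  - exact: ig.
  - move=> n xi /=; rewrite in_itv/= andbT => xi0.
    rewrite normrM ger0_norm ?expR_ge0//.
    apply: (@le_trans _ _ (1 * `|a xi * cos (z * xi) - b xi * sin (z * xi)|)).
      by rewrite ler_wpM2r// -expR0 ler_expR oppr_le0 mulr_ge0// invr_ge0.
    rewrite mul1r (le_trans (ler_normB _ _))// !normrM.
    by apply: lerD; rewrite ler_piMr// ?ler_norm_cos ?ler_norm_sin.
  by [].
have h3 : c * \int[mu]_x (f x * (n.+1%:R^-1 / (n.+1%:R^-1 ^+ 2 + (x - z) ^+ 2))) @[n --> \oo] -->
  c * (pi * f z) by exact: cvgMr.
have e_gt0 n : 0 < n.+1%:R^-1 :> R by rewrite invr_gt0.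
rewrite (funext (fun n => fourier_poisson z fab (e_gt0 n))) in h2.
have -> := cvg_unique (@Rhausdorff R) h2 h3.
have E : c ^+ 2 = (2 * pi)^-1 by rewrite exprVn sqr_sqrtr// mulr_ge0// ltW.
rewrite !mulrA (_ : 2 * c * c * pi = 1) ?mul1r//.
by rewrite -(mulrA 2) -expr2 E mulrAC divff// mulf_neq0// gt_eqF.
Qed.

End FourierInversion.

(** * Sobolev embeddings *)

Section Sobolev.
Context {R : realType}.
Local Notation mu := (@lebesgue_measure R).
Implicit Types (f g a b V : R -> R) (z e xi x y r s N : R).

Lemma L2norm_le f g : measurable_fun setT f -> measurable_fun setT g ->
  (forall x, `|f x| <= `|g x|) -> (L2norm f <= L2norm g)%E.
Proof.
move=> mf mg fg; rewrite !L2normE; apply: gt0_ler_poweR.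
- by rewrite invr_ge0.
- by rewrite in_itv/= leey integral_ge0// => x _; rewrite lee_fin sqr_ge0.
- by rewrite in_itv/= leey integral_ge0// => x _; rewrite lee_fin sqr_ge0.
- apply: ge0_le_integral => //.
  + by move=> x _; rewrite lee_fin sqr_ge0.
  + by apply/measurable_EFinP; exact: measurable_funX.
  + by apply/measurable_EFinP; exact: measurable_funX.
  + move=> x _; rewrite lee_fin -[leLHS]real_normK ?num_real//.
    by rewrite -[leRHS]real_normK ?num_real// lerXn2r ?nnegrE.
Qed.

Lemma measurable_bessel r : measurable_fun setT (fun xi : R => (1 + xi ^+ 2) `^ r).
Proof.
apply: (measurableT_comp (measurable_powR r)).
by apply: measurable_funD => //; exact: measurable_funX.
Qed.

(** From (1 + x)^2 <= 2 (1 + x^2), the weight is at most 2^r (1 + x)^{- 2 r}, which has an explicit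
    primitive; [q] = 2 r - 1 is the exponent with which that primitive decays. *)
Lemma integrable_bessel r : 1 / 2 < r ->
  mu.-integrable `[0, +oo[ (EFin \o (fun xi => (1 + xi ^+ 2) `^ (- r))).
Proof.
move=> r12; pose q := 2 * r - 1.
have q0 : 0 < q by rewrite subr_gt0 mulrC -ltr_pdivrMr.
pose f x := (1 + x) `^ (- q - 1).
pose F x := - ((1 + x) `^ (- q) / q).
have dp p x : -1 < x -> is_derive x (1 : R) (fun x => (1 + x) `^ p) (p * (1 + x) `^ (p - 1)).
  move=> x1; have x10 : 0 < 1 + x by rewrite -ltrBlDl sub0r.
  have h : is_derive x (1 : R) (fun x => 1 + x) 1.
    by apply: is_derive_eq; rewrite add0r mulr1.
  have := @is_derive1_comp R (fun y : R => y `^ p) (fun x => 1 + x) x _ _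
    (@is_derive1_powR R p (1 + x) x10) h.
  by rewrite mulr1.
have [] := @ge0_integrable_FTC2y R f F (-1) 0 0.
- by rewrite ltrN10.
- by move=> x _; exact: powR_ge0.
- by move=> x /(dp (- q - 1)) /is_derive_continuous.
- move=> x x1; have h := dp (- q) x x1.
  rewrite /F; apply: is_derive_eq; rewrite /GRing.scale/= /f; field.
  by rewrite gt_eqF.
- rewrite -oppr0; apply: cvgN; rewrite -(mul0r q^-1); apply: cvgMl.
  apply/cvgr0Pnorm_le => e e0; near=> x.
  have x10 : 0 < 1 + x.
    by rewrite -ltrBlDl sub0r; near: x; apply: nbhs_pinfty_gt; exact: num_real.
  rewrite ger0_norm ?powR_ge0// powRN -[leRHS]invrK lef_pV2 ?posrE ?powR_gt0 ?invr_gt0//.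
  have -> : e^-1 = (e^-1 `^ q^-1) `^ q.
    by rewrite -powRrM mulVf ?gt_eqF// powRr1// invr_ge0 ltW.
  apply: ge0_ler_powR; rewrite ?nnegrE ?powR_ge0 ?(ltW x10) ?(ltW q0)//.
  by rewrite -lerBlDl; near: x; apply: nbhs_pinfty_ge; exact: num_real.
move=> fi _.
apply: (@le_integrable_real _ _ _ mu _ _ (fun x => 2 `^ r * f x)) => //.
- by apply: measurable_funTS; exact: measurable_bessel.
- move=> x /=; rewrite in_itv/= andbT => x0.
  have x1 : 0 < 1 + x by rewrite ltr_pwDl.
  have x2 : 0 < 1 + x ^+ 2 by rewrite ltr_pwDl// sqr_ge0.
  rewrite ger0_norm ?powR_ge0//.
  have -> : f x = ((1 + x) ^+ 2) `^ (- r).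
    by rewrite -powR_mulrn ?ltW// -powRrM /f /q; congr (_ `^ _); ring.
  rewrite !powRN ler_pdivlMr ?powR_gt0 ?exprn_gt0// mulrC.
  rewrite ler_pdivrMr ?powR_gt0// -powRM//; last exact: ltW.
  apply: ge0_ler_powR; rewrite ?nnegrE ?sqr_ge0//.
  + by rewrite (le_trans _ (ltW r12)).
  + by rewrite mulr_ge0// ltW.
  + have := sqr_ge0 (x - 1); lra.
- exact: integrableZ_real.
Unshelve. all: by end_near. Qed.

(** Cauchy-Schwarz, after writing V as (1 + xi^2)^{- r / 2} times its weighted version. The constant
    is the L^2 norm of the first factor on the half-line, finite because r > 1/2. *)
Lemma weighted_L2_integrable r : 1 / 2 < r -> exists2 C : R, 0 <= C &
  forall V N, measurable_fun setT V ->
  (L2norm (fun xi => (1 + xi ^+ 2)%R `^ (r / 2) * V xi)%R <= N%:E)%E ->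
  mu.-integrable `[0, +oo[ (EFin \o V) /\
  \int[mu]_(xi in `[0, +oo[) `|V xi| <= C * N.
Proof.
move=> r12.
pose w := (fun xi : R => (1 + xi ^+ 2) `^ (- (r / 2))) \_ `[0, +oo[.
have mw : measurable_fun setT w.
  apply/(measurable_restrictT _ _).1 => //.
  by apply: measurable_funTS; exact: measurable_bessel.
have Lw : L2 w.
  apply/L2P; split => //.
  rewrite (_ : (fun x => w x ^+ 2) = (fun xi : R => (1 + xi ^+ 2) `^ (- r)) \_ `[0, +oo[).
    by apply: integrable_restrictT => //; exact: integrable_bessel.
  apply/funext => x; rewrite /w !patchE; case: ifPn => _; last first.
    by rewrite -[point]/(0 : R) expr0n.
  rewrite -powR_mulrn ?powR_ge0// -powRrM; by congr (_ `^ _); field.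
have fw : L2norm w \is a fin_num.
  rewrite ge0_fin_numE ?Lnorm_ge0//.
  by move: Lw; rewrite /L2 inE => /andP[_ /set_mem].
exists (fine (L2norm w)); first by rewrite fine_ge0// Lnorm_ge0.
move=> V N mV hN.
have mwV : measurable_fun setT (fun xi => (1 + xi ^+ 2) `^ (r / 2) * V xi).
  by apply: measurable_funM => //; exact: measurable_bessel.
have [] := L2norm_hoelder (M := fine (L2norm w)) mw mwV _ hN; first by rewrite fineK.
have -> : (fun xi => w xi * ((1 + xi ^+ 2) `^ (r / 2) * V xi)) = V \_ `[0, +oo[.
  apply/funext => x; rewrite /w !patchE; case: ifPn => _; last by rewrite mul0r.
  by rewrite mulrA powRN mulVf ?mul1r// gt_eqF// powR_gt0// ltr_pwDl// sqr_ge0.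
move=> iV hV; split.
  by apply/(integrable_mkcond _ _).2 => //; rewrite restrict_EFin.
apply: le_trans hV; rewrite Rintegral_mkcond le_eqVlt; apply/orP; left; apply/eqP.
apply: eq_Rintegral => x _; rewrite (_ : w x * _ = (V \_ `[0, +oo[) x).
  by rewrite !patchE; case: ifPn => //; rewrite -[point]/(0 : R) normr0.
rewrite /w !patchE; case: ifPn => _; last by rewrite mul0r.
by rewrite mulrA powRN mulVf ?mul1r// gt_eqF// powR_gt0// ltr_pwDl// sqr_ge0.
Qed.

(** A strict bound on an infimum singles out one pair a, b, so that uniqueness of the transform
    never has to be established. The embeddings below therefore take strict bounds on [Hs_norm] as
    hypotheses. *)
Lemma Hs_norm_lt s f N : (Hs_norm s f < N%:E)%E -> exists a b : R -> R,
  is_fourier f a b /\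
  (L2norm (fun xi => ((1 + xi ^+ 2) `^ (s / 2) * Num.sqrt (a xi ^+ 2 + b xi ^+ 2))%R)
    <= N%:E)%E.
Proof.
by move=> /ereal_inf_lt[y [a [b [fab ->]]] /ltW h]; exists a, b.
Qed.

Lemma measurable_amplitude a b : measurable_fun setT a -> measurable_fun setT b ->
  measurable_fun setT (fun xi => Num.sqrt (a xi ^+ 2 + b xi ^+ 2)).
Proof.
move=> ma mb; apply: measurableT_comp.
  by apply: continuous_measurable_fun; exact: sqrt_continuous.
by apply: measurable_funD; exact: measurable_funX.
Qed.

Lemma ler_amplitude (u v : R) : `|u| <= Num.sqrt (u ^+ 2 + v ^+ 2) /\
  `|v| <= Num.sqrt (u ^+ 2 + v ^+ 2).
Proof.
by split; rewrite -sqrtr_sqr ler_wsqrtr// ?lerDl ?lerDr sqr_ge0.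
Qed.

(** Since |xi|^p <= (1 + xi^2)^{p / 2}, a moment of order p uses up p of the s derivatives, and the
    remaining s - p exceed 1/2. The cases p = 0 and p = 1 give the embeddings in C^0 and C^1; the
    factor 2 in the constant counts a and b. *)
Lemma fourier_moment_integrable (p : nat) s : p%:R + 1 / 2 < s ->
  exists2 C : R, 0 <= C & forall a b N, measurable_fun setT a -> measurable_fun setT b ->
  (L2norm (fun xi => ((1 + xi ^+ 2) `^ (s / 2) * Num.sqrt (a xi ^+ 2 + b xi ^+ 2))%R)
    <= N%:E)%E ->
  [/\ mu.-integrable `[0, +oo[ (EFin \o (fun xi => xi ^+ p * a xi)),
      mu.-integrable `[0, +oo[ (EFin \o (fun xi => xi ^+ p * b xi)) &
      \int[mu]_(xi in `[0, +oo[) (`|xi ^+ p * a xi| + `|xi ^+ p * b xi|) <= C * N].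
Proof.
move=> ps; have r12 : 1 / 2 < s - p%:R by rewrite ltrBrDl.
have [C C0 hC] := weighted_L2_integrable r12.
exists (2 * C); first by rewrite mulr_ge0.
move=> a b N ma mb hN.
pose V xi := xi ^+ p * Num.sqrt (a xi ^+ 2 + b xi ^+ 2).
have mp : measurable_fun setT (fun xi : R => xi ^+ p) by exact: measurable_funX.
have mamp := measurable_amplitude ma mb.
have mV : measurable_fun setT V by exact: measurable_funM.
have bessel_pow xi : `|xi| ^+ p <= (1 + xi ^+ 2) `^ (p%:R / 2).
  have h : 0 <= 1 + xi ^+ 2 by rewrite addr_ge0// sqr_ge0.
  rewrite mulrC powRrM powR_mulrn ?powR_ge0// powR12_sqrt//.
  by rewrite lerXn2r ?nnegrE ?sqrtr_ge0// -sqrtr_sqr ler_wsqrtr// lerDr.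
have hVN : (L2norm (fun xi => (1 + xi ^+ 2)%R `^ ((s - p%:R) / 2) * V xi)%R <= N%:E)%E.
  apply: le_trans hN; apply: L2norm_le.
  - by apply: measurable_funM => //; exact: measurable_bessel.
  - by apply: measurable_funM => //; exact: measurable_bessel.
  move=> xi; rewrite /V mulrA !normrM ler_wpM2r// normrX.
  rewrite !(ger0_norm (powR_ge0 _ _)).
  have -> : s / 2 = (s - p%:R) / 2 + p%:R / 2 by field.
  rewrite powRD; last by apply/implyP => _; rewrite gt_eqF// ltr_pwDl// sqr_ge0.
  by rewrite ler_wpM2l ?powR_ge0// bessel_pow.
have [iV hV] := hC V N mV hVN.
have aV xi : `|xi ^+ p * a xi| <= `|V xi|.
  rewrite /V !normrM ler_wpM2l// (ger0_norm (sqrtr_ge0 _)).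
  by have [] := ler_amplitude (a xi) (b xi).
have bV xi : `|xi ^+ p * b xi| <= `|V xi|.
  rewrite /V !normrM ler_wpM2l// (ger0_norm (sqrtr_ge0 _)).
  by have [] := ler_amplitude (a xi) (b xi).
have iVn : mu.-integrable `[0, +oo[ (EFin \o (fun xi => `|V xi|)) by exact: integrable_norm.
have ia : mu.-integrable `[0, +oo[ (EFin \o (fun xi => xi ^+ p * a xi)).
  apply: (@le_integrable_real _ _ _ mu _ _ (fun xi => `|V xi|)) => //.
  by apply: measurable_funTS; exact: measurable_funM.
have ib : mu.-integrable `[0, +oo[ (EFin \o (fun xi => xi ^+ p * b xi)).
  apply: (@le_integrable_real _ _ _ mu _ _ (fun xi => `|V xi|)) => //.
  by apply: measurable_funTS; exact: measurable_funM.
split=> //.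
rewrite RintegralD//; [|exact: integrable_norm..].
rewrite (_ : 2 * C * N = C * N + C * N); last by ring.
by apply: lerD; apply: le_trans hV; apply: le_Rintegral => //; exact: integrable_norm.
Qed.

Local Notation c := ((Num.sqrt (2 * pi : R))^-1).

(** Continuity turns inversion into an equality at every point, so that bounds, moduli of continuity
    and derivatives of f can be read off from a trigonometric integral. *)
Lemma Sobolev_repr s f N : 1 / 2 < s -> continuous f -> (Hs_norm s f < N%:E)%E ->
  exists a b : R -> R, [/\ measurable_fun setT a /\ measurable_fun setT b,
  (L2norm (fun xi => ((1 + xi ^+ 2) `^ (s / 2) * Num.sqrt (a xi ^+ 2 + b xi ^+ 2))%R)
    <= N%:E)%E,
   mu.-integrable `[0, +oo[ (EFin \o a), mu.-integrable `[0, +oo[ (EFin \o b) &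
   f = (fun z => 2 * c * trig_int `[0, +oo[ a (fun xi => - b xi) z)].
Proof.
move=> s12 cf /Hs_norm_lt[a [b [fab hN]]]; exists a, b.
have [_ /L2P[ma _] /L2P[mb _] _ _] := fab.
have [|C _ /(_ a b N ma mb hN)[ia ib _]] := @fourier_moment_integrable 0 s.
  by rewrite add0r.
have {}ia : mu.-integrable `[0, +oo[ (EFin \o a).
  by apply: eq_integrable ia => // x _; rewrite /= expr0 mul1r.
have {}ib : mu.-integrable `[0, +oo[ (EFin \o b).
  by apply: eq_integrable ib => // x _; rewrite /= expr0 mul1r.
split=> //; apply/funext => z; apply: fourier_inversion => //; exact: cf.
Qed.

Lemma trig_int_bound_sym a b (C z : R) :
  mu.-integrable `[0, +oo[ (EFin \o a) -> mu.-integrable `[0, +oo[ (EFin \o b) ->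
  \int[mu]_(xi in `[0, +oo[) (`|a xi| + `|b xi|) <= C ->
  `|2 * c * trig_int `[0, +oo[ a b z| <= 2 * c * C.
Proof.
move=> ia ib h.
have c0 : 0 <= 2 * c by rewrite mulr_ge0// invr_ge0 sqrtr_ge0.
rewrite normrM ger0_norm// ler_wpM2l// (le_trans _ h)//.
exact: (trig_int_bound z (measurable_itv _) ia ib).
Qed.

Lemma Sobolev_sup s : 1 / 2 < s -> exists2 C : R, 0 < C &
  forall f N, continuous f -> (Hs_norm s f < N%:E)%E -> forall x, `|f x| <= C * N.
Proof.
move=> s12; have [|C C0 hC] := @fourier_moment_integrable 0 s; first by rewrite add0r.
have c0 : 0 <= 2 * c by rewrite mulr_ge0// invr_ge0 sqrtr_ge0.
(* Adding 1 makes the constant positive, so that tolerances can later be divided by it. *)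
exists (2 * c * C + 1); first by rewrite ltr_wpDl// mulr_ge0.
move=> f N cf hN x.
have N0 : 0 <= N.
  have [a [b [_ /(le_trans (Lnorm_ge0 _ _ _))]]] := Hs_norm_lt hN.
  by rewrite lee_fin.
have [a [b [[ma mb] hab ia ib ->]]] := Sobolev_repr s12 cf hN.
have [_ _ h] := hC a b N ma mb hab.
apply: (@le_trans _ _ (2 * c * (C * N))); last by rewrite mulrA ler_wpM2r// lerDl.
apply: trig_int_bound_sym => //.
  by have := integrableZ_real (mu := mu) (-1) (measurable_itv _) ib;
    apply: eq_integrable => // xi _; rewrite /= mulN1r.
apply: le_trans h; rewrite le_eqVlt; apply/orP; left; apply/eqP.
by apply: eq_Rintegral => xi _; rewrite !expr0 !mul1r normrN.
Qed.

Definition unif_cont f := forall e, 0 < e -> exists2 d : R, 0 < d &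
  forall x y, `|x - y| <= d -> `|f x - f y| <= e.

Lemma trig_int_scaled_unif_cont a b (k : R) :
  mu.-integrable `[0, +oo[ (EFin \o a) -> mu.-integrable `[0, +oo[ (EFin \o b) ->
  unif_cont (fun z => k * trig_int `[0, +oo[ a b z).
Proof.
move=> ia ib e e0; have k1 : 0 < `|k| + 1 by rewrite ltr_wpDl.
have ek : 0 < e / (`|k| + 1) by rewrite divr_gt0.
have [d d0 h] := trig_int_unif_cont (measurable_itv `[0%R, +oo[) ia ib ek.
exists d => // x y xy; rewrite -mulrBr normrM.
apply: (@le_trans _ _ ((`|k| + 1) * (e / (`|k| + 1)))).
  by apply: ler_pM => //; [rewrite lerDl|exact: h].
by rewrite mulrC divfK// gt_eqF.
Qed.

Lemma lty_ex (x : \bar R) : (x < +oo)%E -> exists N : R, (x < N%:E)%E.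
Proof.
by case: x => [r _|//|_]; [exists (r + 1); rewrite lte_fin ltrDl|exists 0; rewrite ltNyr].
Qed.

Lemma Sobolev_unif_cont s f : 1 / 2 < s -> continuous f -> (Hs_norm s f < +oo)%E ->
  unif_cont f.
Proof.
move=> s12 cf /lty_ex[N hN].
have [a [b [_ _ ia ib ->]]] := Sobolev_repr s12 cf hN.
apply: trig_int_scaled_unif_cont => //.
by have := integrableZ_real (mu := mu) (-1) (measurable_itv _) ib;
  apply: eq_integrable => // xi _; rewrite /= mulN1r.
Qed.

(** Integrable first moments permit differentiation under the integral; the derivative is again a
    trigonometric integral with integrable coefficients, hence bounded and uniformly continuous. *)
Lemma Sobolev_C1 s : 3 / 2 < s -> exists2 C : R, 0 < C &
  forall f N, continuous f -> (Hs_norm s f < N%:E)%E ->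
  [/\ forall x, derivable f x 1, forall x, `|derive1 f x| <= C * N & unif_cont (derive1 f)].
Proof.
move=> s32; have s12 : 1 / 2 < s by lra.
have [|C C0 hC] := @fourier_moment_integrable 1 s; first by lra.
have c0 : 0 <= 2 * c by rewrite mulr_ge0// invr_ge0 sqrtr_ge0.
exists (2 * c * C + 1); first by rewrite ltr_wpDl// mulr_ge0.
move=> f N cf hN.
have N0 : 0 <= N.
  have [a [b [_ /(le_trans (Lnorm_ge0 _ _ _))]]] := Hs_norm_lt hN.
  by rewrite lee_fin.
have [a [b [[ma mb] hab ia ib fE]]] := Sobolev_repr s12 cf hN.
have [ia1 ib1 h] := hC a b N ma mb hab.
have mD : measurable (`[0, +oo[%classic : set R) by exact: measurable_itv.
have ibN : mu.-integrable `[0, +oo[ (EFin \o (fun xi => - b xi)).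
  by have := integrableZ_real (mu := mu) (-1) mD ib;
    apply: eq_integrable => // xi _; rewrite /= mulN1r.
have ixa : mu.-integrable `[0, +oo[ (EFin \o (fun xi => xi * a xi)).
  by apply: eq_integrable ia1 => // xi _; rewrite /= expr1.
have ixb : mu.-integrable `[0, +oo[ (EFin \o (fun xi => xi * - b xi)).
  by have := integrableZ_real (mu := mu) (-1) mD ib1;
    apply: eq_integrable => // xi _; rewrite /= expr1 mulN1r mulrN.
have ixaN : mu.-integrable `[0, +oo[ (EFin \o (fun xi => - (xi * a xi))).
  by have := integrableZ_real (mu := mu) (-1) mD ixa;
    apply: eq_integrable => // xi _; rewrite /= mulN1r.
have df x : is_derive x (1 : R) f (2 * c *
    trig_int `[0, +oo[ (fun xi => xi * - b xi) (fun xi => - (xi * a xi)) x).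
  rewrite fE; have := is_derive_trig_int x mD ia ibN ixa ixb.
  by move=> /(is_deriveZ (2 * c)).
have dfE : derive1 f = fun x => 2 * c *
    trig_int `[0, +oo[ (fun xi => xi * - b xi) (fun xi => - (xi * a xi)) x.
  by apply/funext => x; rewrite derive1E; have hx := df x; rewrite derive_val.
split.
- by move=> x; have [] := df x.
- move=> x; rewrite dfE; apply: (@le_trans _ _ (2 * c * (C * N))).
    apply: trig_int_bound_sym => //; apply: le_trans h; rewrite le_eqVlt.
    apply/orP; left; apply/eqP; apply: eq_Rintegral => xi _.
    by rewrite !expr1 mulrN !normrN addrC.
  by rewrite mulrA ler_wpM2r// lerDl.
- by rewrite dfE; exact: trig_int_scaled_unif_cont.
Qed.

End Sobolev.

(** * Decay at infinity *)

Section Decay.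
Context {R : realType}.
Local Notation mu := (@lebesgue_measure R).
Implicit Types (f g F : R -> R) (z e x y M L : R).

Lemma Rintegral_subset_le (A B : set R) f : measurable A -> measurable B ->
  A `<=` B -> (forall x, B x -> 0 <= f x) -> mu.-integrable B (EFin \o f) ->
  \int[mu]_(x in A) f x <= \int[mu]_(x in B) f x.
Proof.
move=> mA mB AB f0 iB; have iA : mu.-integrable A (EFin \o f) by exact: integrableS iB.
rewrite /Rintegral fine_le ?integrable_fin_num//.
apply: ge0_subset_integral => //; first exact: measurable_int iB.
Qed.

Lemma Rintegral_cst_itv a b M : a <= b -> \int[mu]_(x in `[a, b]) M = M * (b - a).
Proof.
move=> ab; rewrite Rintegral_cst//= lebesgue_measure_itv/= lte_fin.
by case: ltgtP ab => // ->; rewrite subrr.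
Qed.

Lemma Rintegral_ge_cst f a b M : a <= b -> mu.-integrable `[a, b] (EFin \o f) ->
  (forall x, a <= x <= b -> M <= f x) -> M * (b - a) <= \int[mu]_(x in `[a, b]) f x.
Proof.
move=> ab fi fM.
rewrite -Rintegral_cst_itv//.
apply: le_Rintegral => //; first by apply: continuous_integrable_itv => x; exact: cvg_cst.
Qed.

Lemma Rintegral_le_cst f a b M : a <= b -> mu.-integrable `[a, b] (EFin \o f) ->
  (forall x, a <= x <= b -> `|f x| <= M) -> `|\int[mu]_(x in `[a, b]) f x| <= M * (b - a).
Proof.
move=> ab fi fM.
rewrite -Rintegral_cst_itv//.
apply: Rintegral_le_norm => //.
- by apply: continuous_integrable_itv => x; exact: cvg_cst.
- exact: integrable_fun_measurable fi.
Qed.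

Lemma ge0_Rintegral_eq0 f : continuous f -> (forall x, 0 <= f x) ->
  mu.-integrable setT (EFin \o f) -> \int[mu]_x f x = 0 -> forall x, f x = 0.
Proof.
move=> cf f0 fi f00 z; apply/eqP; rewrite eq_le f0 andbT leNgt; apply/negP => fz.
have fz2 : 0 < f z / 2 by rewrite divr_gt0.
have /cvgrPdist_le /(_ _ fz2) [d /= d0 hd] := cf z.
have : f z / 2 * (z + d / 2 - z) <= \int[mu]_(x in `[z, z + d / 2]) f x.
  apply: Rintegral_ge_cst.
  - by rewrite lerDl divr_ge0// ltW.
  - exact: continuous_integrable_itv.
  - move=> x /andP[zx xd]; have : `|f z - f x| <= f z / 2.
      apply: hd => /=; rewrite distrC ger0_norm ?subr_ge0//.
      by rewrite ltrBlDl (le_lt_trans xd)// ltrD2l ltr_pdivrMr// ltr_pMr// ltr1n.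
    by rewrite ler_norml => /andP[_]; lra.
apply/negP; rewrite -ltNge (@le_lt_trans _ _ 0)//.
  by rewrite -f00; apply: Rintegral_subset_le.
by rewrite mulr_gt0// addrAC subrr add0r divr_gt0.
Qed.

Definition vanishes_at_infinity f := forall e, 0 < e ->
  exists L : R, forall x, L <= `|x| -> `|f x| <= e.

Lemma unif_cont_continuous f : unif_cont f -> continuous f.
Proof.
move=> h x; apply/cvgrPdist_le => e /h[d d0 hd].
near=> y; apply: hd; near: y; apply: cvgr_dist_le => //; exact: cvg_id.
Unshelve. all: by end_near. Qed.

(** If |f x| > e, uniform continuity keeps |f| >= e / 2 on [[x, x + d]], which contributes at least
    (e / 2)^2 d to the integral of f^2. Far out this interval is disjoint from [[- n%:R, n%:R]],
    which already carries all but half of that amount. *)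
Lemma L2_unif_cont_vanishes f : L2 f -> unif_cont f -> vanishes_at_infinity f.
Proof.
move=> /L2P[mf fi] uf e e0.
have e2 : 0 < e / 2 by rewrite divr_gt0.
have [d d0 hd] := uf _ e2.
have cf : continuous (fun x => f x ^+ 2).
  by move=> x; apply: cvgM; exact: unif_cont_continuous.
have f20 x : 0 <= f x ^+ 2 by exact: sqr_ge0.
have lim := @Rintegral_exhaust _ _ _ mu setT (fun n => `[- n%:R, n%:R]%classic)
  (fun x => f x ^+ 2).
have {}lim : \int[mu]_(x in `[- n%:R, n%:R]) (f x ^+ 2) @[n --> \oo] --> \int[mu]_x (f x ^+ 2).
  apply: lim => //.
  move=> x _; near=> n; rewrite /= in_itv/= -ler_norml.
  near: n; exact: nbhs_infty_ger.
have tol : 0 < (e / 2) ^+ 2 * d / 2 by rewrite divr_gt0// mulr_gt0// exprn_gt0.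
have /cvgrPdist_le /(_ _ tol) [n _ /(_ n (leqnn n)) hn] := lim.
(* The margin d matters for negative x, where [[x, x + d]] extends towards the origin. *)
exists (n%:R + d + 1) => x xL; rewrite leNgt; apply/negP => fx.
have disj : [disjoint `[- n%:R, n%:R]%classic & `[x, x + d]%classic].
  apply/disj_setPS => y [] /=; rewrite !in_itv/= => /andP[y1 y2] /andP[y3 y4].
  have [N [{}y1 {}y2 {}xL]] : exists N : R, [/\ - N <= y, y <= N & N + d + 1 <= `|x|].
    by exists n%:R.
  have [x0|x0] := leP 0 x; first by move: xL; rewrite ger0_norm//; lra.
  by move: xL; rewrite ltr0_norm//; lra.
have lower : (e / 2) ^+ 2 * (x + d - x) <= \int[mu]_(y in `[x, x + d]) (f y ^+ 2).
  apply: Rintegral_ge_cst.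
  - by rewrite lerDl ltW.
  - exact: continuous_integrable_itv.
  - move=> y /andP[xy yd]; rewrite -[leRHS]real_normK ?num_real//.
    rewrite lerXn2r ?nnegrE ?(ltW e2)//.
    have : `|x - y| <= d by rewrite distrC ger0_norm ?subr_ge0// lerBlDl.
    move=> /hd h; have := ler_normD (f y) (f x - f y); rewrite subrKC; lra.
have total : \int[mu]_(y in `[- n%:R, n%:R]) (f y ^+ 2) + \int[mu]_(y in `[x, x + d]) (f y ^+ 2)
    <= \int[mu]_y (f y ^+ 2).
  rewrite -Rintegral_setU//; first by apply: Rintegral_subset_le => //; exact: measurableU.
  by apply: integrableS fi => //; exact: measurableU.
have contra (I J K q : R) : 0 < q / 2 -> I - J <= q / 2 -> q <= K -> J + K <= I -> False.
  by clear; lra.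
rewrite [x + d]addrC addrK in lower.
by apply: contra tol (le_trans (ler_norm _) hn) lower _; rewrite [d + x]addrC.
Unshelve. all: by end_near. Qed.

(** Barbalat's argument: |f| is at most e d / 4 at x and at x + d, so the mean value theorem yields
    a point between them where the derivative is at most e / 2 in absolute value; uniform continuity
    carries this back to x. *)
Lemma unif_cont_derive1_vanishes f : (forall x, derivable f x 1) ->
  vanishes_at_infinity f -> unif_cont (derive1 f) -> vanishes_at_infinity (derive1 f).
Proof.
move=> df vf uf e e0.
have e2 : 0 < e / 2 by rewrite divr_gt0.
have [d d0 hd] := uf _ e2.
have ed : 0 < e * d / 4 by rewrite divr_gt0// mulr_gt0.
have [L hL] := vf _ ed.
exists (L + d) => x xL.
have dfx y : is_derive y (1 : R) f (derive1 f y).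
  by apply: DeriveDef; rewrite ?derive1E.
have xd : x <= x + d by rewrite lerDl ltW.
have cf : continuous f by move=> y; exact: is_derive_continuous (dfx y).
have [c] := MVT_segment xd (fun y _ => dfx y) (continuous_subspaceT cf).
rewrite in_itv/= => /andP[c1 c2]; rewrite [x + d]addrC addrK => E.
have h1 : `|f x| <= e * d / 4 by apply: hL; lra.
have h2 : `|f (d + x)| <= e * d / 4.
  apply: hL; have := ler_normB (d + x) d; rewrite addrAC subrr add0r (gtr0_norm d0); lra.
have h3 : `|derive1 f c| <= e / 2.
  have : `|derive1 f c| * d <= e / 2 * d.
    rewrite -[X in _ * X](gtr0_norm d0) -normrM -E (le_trans (ler_normB _ _))//; lra.
  by rewrite ler_pM2r.
have h4 : `|derive1 f x - derive1 f c| <= e / 2.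
  by apply: hd; rewrite distrC ger0_norm ?subr_ge0//; lra.
have := ler_normD (derive1 f c) (derive1 f x - derive1 f c); rewrite subrKC; lra.
Qed.

End Decay.

(** * The operator (1 - d_x^2)^{-1} *)

Section HelmholtzInverse.
Context {R : realType}.
Local Notation mu := (@lebesgue_measure R).
Implicit Types (f g F G : R -> R) (z e x y M L : R).

Lemma cvgNy_expR : expR x @[x --> -oo] --> (0 : R).
Proof. exact/cvgNy_compNP/cvgr_expR. Qed.

Lemma green_kernel x : let k y := expR (- `|x - y|) / 2 in
  mu.-integrable setT (EFin \o k) /\ \int[mu]_y k y = 1.
Proof.
move=> k.
have cd (f f' : R -> R) : (forall y, is_derive y (1 : R) f (f' y)) -> continuous f.
  by move=> df y; exact: is_derive_continuous (df y).
have mk : measurable_fun setT k.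
  apply: continuous_measurable_fun => y; apply: cvgMl.
  apply: (@continuous_comp _ _ _ (fun y => - `|x - y|) (@expR R)); last exact: continuous_expR.
  apply: cvgN; apply: (@continuous_comp _ _ _ (fun y => x - y) (fun u : R => `|u|));
    last exact: norm_continuous.
  by apply: cvgB; [exact: cvg_cst|exact: cvg_id].
pose f1 y := expR (y - x) / 2; pose f2 y := expR (x - y) / 2.
have df1 y : is_derive y (1 : R) f1 (f1 y).
  by rewrite /f1; apply: is_derive_eq; rewrite /GRing.scale/=; ring.
have df2 y : is_derive y (1 : R) (fun y => - f2 y) (f2 y).
  by rewrite /f2; apply: is_derive_eq; rewrite /GRing.scale/=; ring.
have cf2 : continuous f2.
  apply: (cd _ (fun y => - f2 y)) => y.
  by rewrite /f2; apply: is_derive_eq; rewrite /GRing.scale/=; ring.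
have f1Ny : f1 y @[y --> -oo] --> (0 : R).
  rewrite -(mul0r 2^-1); apply: cvgMl.
  under eq_fun do rewrite expRD.
  by rewrite -(mul0r (expR (- x))); apply: cvgMl; exact: cvgNy_expR.
have f2y : - f2 y @[y --> +oo] --> (0 : R).
  rewrite -oppr0; apply: cvgN; rewrite -(mul0r 2^-1); apply: cvgMl.
  under eq_fun do rewrite expRD.
  by rewrite -(mulr0 (expR x)); apply: cvgMr; exact: cvgr_expR.
have [i1 E1] := @ge0_integrable_FTC2Ny R f1 f1 x 0
  (fun y => divr_ge0 (expR_ge0 _) (ler0n _ _)) (cd _ _ df1) df1 f1Ny.
have [|i2 E2] := @ge0_integrable_FTC2y R f2 (fun y => - f2 y) (x - 1) x 0 _
  (fun y _ => divr_ge0 (expR_ge0 _) (ler0n _ _)) (fun y _ => cf2 y)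
  (fun y _ => df2 y) f2y; first by rewrite ltrBlDr ltrDl ltr01.
have k1 y : y \in `]-oo, x]%classic -> f1 y = k y.
  rewrite inE/= in_itv/= => yx; rewrite /f1 /k ger0_norm ?subr_ge0//.
  by rewrite opprB.
have k2 y : y \in `[x, +oo[%classic -> f2 y = k y.
  rewrite inE/= in_itv/= andbT => xy; rewrite /f2 /k distrC ger0_norm ?subr_ge0//.
  by rewrite opprB.
have [||ik ->] := integrable_itv_split (f := k) (z := x) mk.
- by apply: eq_integrable i1 => // y /k1 /= ->.
- by apply: eq_integrable i2 => // y /k2 /= ->.
split=> //.
have -> : 1 = (f1 x - 0) + (0 - - f2 x) by rewrite /f1 /f2 subrr expR0; field.
rewrite -E1 -E2; congr (_ + _); apply: eq_Rintegral => y yx; first by rewrite k1.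
by rewrite k2.
Qed.

Lemma green_integrable F M x : continuous F -> (forall y, `|F y| <= M) ->
  mu.-integrable setT (EFin \o (fun y => expR (- `|x - y|) / 2 * F y)).
Proof.
move=> cF FM; have [ik _] := green_kernel x.
apply: (@integrableM_bounded _ _ _ mu _ _ _ M) => //.
exact: continuous_measurable_fun.
Qed.

Lemma Lambda_inv2_bound F M x : continuous F -> (forall y, `|F y| <= M) ->
  `|Lambda_inv2 F x| <= M.
Proof.
move=> cF FM; have [ik Ek] := green_kernel x; rewrite /Lambda_inv2.
have EM : M = \int[mu]_y (M * (expR (- `|x - y|) / 2)) by rewrite RintegralZl// Ek mulr1.
rewrite [leRHS]EM.
apply: Rintegral_le_norm => //; first exact: integrableZ_real.
  by have /integrable_fun_measurable := green_integrable x cF FM.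
move=> y _; rewrite normrM (@ger0_norm _ (expR _ / 2)) ?divr_ge0 ?expR_ge0// mulrC.
by rewrite ler_wpM2r ?divr_ge0 ?expR_ge0.
Qed.

Lemma Lambda_inv2_dist F G M e x : continuous F -> continuous G ->
  (forall y, `|F y| <= M) -> (forall y, `|G y| <= M) -> (forall y, `|F y - G y| <= e) ->
  `|Lambda_inv2 F x - Lambda_inv2 G x| <= e.
Proof.
move=> cF cG FM GM FG.
have iF := green_integrable x cF FM; have iG := green_integrable x cG GM.
rewrite /Lambda_inv2 -RintegralB//.
have := @Lambda_inv2_bound (fun y => F y - G y) e x _ FG.
rewrite /Lambda_inv2; under eq_Rintegral do rewrite mulrBr.
by apply; move=> y; apply: cvgB; [exact: cF|exact: cG].
Qed.

(** Outside [[- L, L]], |F| is at most e / 2 and the kernel has mass 1. Inside, the kernel is at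
    most e^{- t} / 2 with t = |x| - L, which contributes M L e^{- t}; this is at most e / 2 once t
    >= 2 M L / e, because e^t >= t. *)
Lemma Lambda_inv2_vanishes F M : continuous F -> (forall y, `|F y| <= M) ->
  vanishes_at_infinity F -> vanishes_at_infinity (Lambda_inv2 F).
Proof.
move=> cF FM vF e e0.
have M0 : 0 <= M by exact: le_trans (FM 0).
have e2 : 0 < e / 2 by rewrite divr_gt0.
have [L0 hL0] := vF _ e2.
pose L := Num.max L0 0.
have L_ge0 : 0 <= L by rewrite le_max lexx orbT.
have hL y : L <= `|y| -> `|F y| <= e / 2.
  by rewrite ge_max => /andP[+ _]; exact: hL0.
exists (L + 2 * M * L / e) => x xL.
pose t := `|x| - L.
have t0 : 2 * M * L / e <= t by rewrite /t lerBrDl.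
have t0' : 0 <= t by rewrite (le_trans _ t0)// divr_ge0 ?(ltW e0)// !mulr_ge0.
pose h y := e / 2 * (expR (- `|x - y|) / 2) + (fun=> M * (expR (- t) / 2)) \_ `[- L, L] y.
have [ik Ek] := green_kernel x.
have ic : mu.-integrable `[- L, L] (EFin \o (fun=> M * (expR (- t) / 2))).
  by apply: continuous_integrable_itv => y; exact: cvg_cst.
have icT : mu.-integrable setT (EFin \o ((fun=> M * (expR (- t) / 2)) \_ `[- L, L])).
  exact: integrable_restrictT.
have ih : mu.-integrable setT (EFin \o h).
  by apply: integrableD_real => //; exact: integrableZ_real.
apply: (@le_trans _ _ (\int[mu]_y h y)).
  apply: Rintegral_le_norm => //.
    by have /integrable_fun_measurable := green_integrable x cF FM.
  move=> y _; rewrite /h normrM (@ger0_norm _ (expR _ / 2)) ?divr_ge0 ?expR_ge0//.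
  have [yL|yL] := leP L `|y|.
    rewrite ler_wpDr//; last by rewrite mulrC ler_wpM2r ?divr_ge0 ?expR_ge0// hL.
    by rewrite patchE; case: ifPn => // _; rewrite !mulr_ge0 ?expR_ge0.
  rewrite ler_wpDl ?mulr_ge0 ?expR_ge0 ?(ltW e0)//.
  rewrite patchE mem_set; last by rewrite /= in_itv/= -ler_norml ltW.
  rewrite mulrC; apply: ler_pM; rewrite ?divr_ge0 ?expR_ge0//.
  rewrite ler_wpM2r// ler_expR lerN2 /t.
  have := ler_normD (x - y) y; rewrite subrK; lra.
rewrite RintegralD//; last exact: integrableZ_real.
rewrite RintegralZl// Ek mulr1 -Rintegral_mkcond Rintegral_cst_itv; last by lra.
rewrite [leRHS](splitr e) lerD2l opprK.
have -> : M * (expR (- t) / 2) * (L + L) = M * L * expR (- t) by field.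
rewrite expRN ler_pdivrMr ?expR_gt0//.
have h1 : 1 + t <= expR t by exact: expR_ge1Dx.
have h2 : M * L <= e / 2 * t.
  have := t0; rewrite ler_pdivrMr// => h3; lra.
by apply: (le_trans h2); rewrite ler_wpM2l ?(ltW e2)// (le_trans _ h1)// lerDr.
Qed.

(** The integral over the right half-line is obtained from this one by reflecting F, so that a
    single derivative lemma serves for both. *)
Definition exp_primitive F x := \int[mu]_(y in `]-oo, x]) (expR y * F y).

Lemma exp_primitive_integrable F M x : continuous F -> (forall y, `|F y| <= M) ->
  mu.-integrable `]-oo, x] (EFin \o (fun y => expR y * F y)).
Proof.
move=> cF FM.
have [i _] := @ge0_integrable_FTC2Ny R (@expR R) (@expR R) x 0 (@expR_ge0 R)
  (@continuous_expR R) (@is_derive_expR R) cvgNy_expR.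
apply: (@integrableM_bounded _ _ _ mu _ _ _ M) => //.
by apply: measurable_funTS; exact: continuous_measurable_fun.
Qed.

Lemma is_derive_exp_primitive F M x : continuous F -> (forall y, `|F y| <= M) ->
  is_derive x (1 : R) (exp_primitive F) (expR x * F x).
Proof.
move=> cF FM.
have x1 : x < x + 1 by rewrite ltrDl ltr01.
have cf : {for x, continuous (fun y => expR y * F y)}.
  by apply: cvgM; [exact: continuous_expR|exact: cF].
have [] := continuous_FTC1 x1 (exp_primitive_integrable (x + 1) cF FM) (ltNyr _) cf.
by move=> d E; apply: DeriveDef; [exact: d|rewrite -derive1E; exact: E].
Qed.

(* [exp_primitive (F \o -%R) (- x)] is the integral of [e^{-y} F y] over [x, +oo[. *)
Lemma Lambda_inv2E F M x : continuous F -> (forall y, 0 <= F y) -> (forall y, `|F y| <= M) ->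
  Lambda_inv2 F x = expR (- x) / 2 * exp_primitive F x +
    expR x / 2 * exp_primitive (F \o -%R) (- x).
Proof.
move=> cF F0 FM.
have cFN : continuous (F \o -%R).
  by move=> y; apply: continuous_comp; [exact: opp_continuous|exact: cF].
have iT := green_integrable x cF FM.
have i1 := exp_primitive_integrable x cF FM.
have mT : measurable_fun setT (fun y => expR (- `|x - y|) / 2 * F y).
  by have /integrable_fun_measurable := iT.
have [||_] := integrable_itv_split (z := x) mT.
- exact: integrableS iT.
- exact: integrableS iT.
rewrite -/(Lambda_inv2 F x) => ->; congr (_ + _).
  rewrite /exp_primitive -RintegralZl//; apply: eq_Rintegral => y.
  rewrite inE/= in_itv/= => yx; rewrite ger0_norm ?subr_ge0// opprB expRD; ring.
have E : \int[mu]_(y in `[x, +oo[) (expR (- y) * F y) = exp_primitive (F \o -%R) (- x).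
  rewrite /exp_primitive /Rintegral.
  rewrite (ge0_integration_by_substitutionNy (G := fun y => expR y * (F \o -%R) y)).
  - by congr fine; apply: eq_integral => y _ /=; rewrite opprK.
  - apply: continuous_subspaceT => y.
    by apply: cvgM; [exact: continuous_expR|exact: cFN].
  - by move=> y _; rewrite mulr_ge0 ?expR_ge0// F0.
have i2 : mu.-integrable `[x, +oo[ (EFin \o (fun y => expR (- y) * F y)).
  have mD : measurable (`[x, +oo[%classic : set R) by exact: measurable_itv.
  have iS : mu.-integrable `[x, +oo[ (EFin \o (fun y => expR (- `|x - y|) / 2 * F y)).
    exact: integrableS iT.
  have i3 := integrableZ_real (mu := mu) (2 * expR (- x)) mD iS.
  apply: eq_integrable i3 => // y; rewrite inE/= in_itv/= andbT => xy.
  rewrite /= distrC ger0_norm ?subr_ge0// opprB expRD; congr EFin.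
  transitivity (expR (- x) * expR x * (expR (- y) * F y)); first by field.
  by rewrite -expRD addNr expR0 mul1r.
rewrite -E -RintegralZl//; apply: eq_Rintegral => y.
rewrite inE/= in_itv/= andbT => xy; rewrite distrC ger0_norm ?subr_ge0// opprB expRD; ring.
Qed.

Definition dLambda_inv2 F x := expR x / 2 * exp_primitive (F \o -%R) (- x) -
  expR (- x) / 2 * exp_primitive F x.

(** In differentiating [Lambda_inv2E], the two half-line integrals produce F(x) / 2 and - F(x) / 2,
    which cancel; only the exponential prefactors contribute. *)
Lemma is_derive_Lambda_inv2 F M x : continuous F -> (forall y, 0 <= F y) ->
  (forall y, `|F y| <= M) -> is_derive x (1 : R) (Lambda_inv2 F) (dLambda_inv2 F x).
Proof.
move=> cF F0 FM.
have cFN : continuous (F \o -%R).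
  by move=> y; apply: continuous_comp; [exact: opp_continuous|exact: cF].
rewrite (funext (fun x => Lambda_inv2E x cF F0 FM)).
have d1 := is_derive_exp_primitive x cF FM.
have d2 := is_derive_exp_primitive (- x) cFN (fun y => FM (- y)).
have d3 : is_derive x (1 : R) (fun x => exp_primitive (F \o -%R) (- x))
    (expR (- x) * F x * -1).
  have := is_derive1_comp d2 (is_deriveN (is_derive_id x 1)).
  by rewrite /= opprK.
apply: is_derive_eq; rewrite /GRing.scale/= /dLambda_inv2.
have e1 : expR (- x) * expR x = 1 by rewrite -expRD addNr expR0.
ring: e1.
Qed.

Lemma continuous_dLambda_inv2 F M : continuous F -> (forall y, `|F y| <= M) ->
  continuous (dLambda_inv2 F).
Proof.
move=> cF FM x.
have cFN : continuous (F \o -%R).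
  by move=> y; apply: continuous_comp; [exact: opp_continuous|exact: cF].
have c1 : {for x, continuous (exp_primitive F)}.
  exact: is_derive_continuous (is_derive_exp_primitive x cF FM).
have c2 : {for x, continuous (exp_primitive (F \o -%R) \o -%R)}.
  apply: continuous_comp; first exact: opp_continuous.
  exact: is_derive_continuous (is_derive_exp_primitive (- x) cFN (fun y => FM (- y))).
have c3 : {for x, continuous (fun x : R => expR (- x))}.
  by apply: continuous_comp; [exact: opp_continuous|exact: continuous_expR].
apply: cvgB.
- by apply: cvgM; [apply: cvgMl; exact: continuous_expR|exact: c2].
- by apply: cvgM; [apply: cvgMl; exact: c3|exact: c1].
Qed.

Lemma dLambda_inv2_eq0 F M a b : continuous F -> (forall y, 0 <= F y) ->
  (forall y, `|F y| <= M) -> a < b -> (forall y, a <= y <= b -> F y = 0) ->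
  dLambda_inv2 F a = 0 -> dLambda_inv2 F b = 0 -> forall y, F y = 0.
Proof.
move=> cF F0 FM ab Fab da db.
have cFN : continuous (F \o -%R).
  by move=> y; apply: continuous_comp; [exact: opp_continuous|exact: cF].
have dP y := is_derive_exp_primitive y cF FM.
have dPN y := is_derive_exp_primitive y cFN (fun y => FM (- y)).
have E1 : exp_primitive F b = exp_primitive F a.
  have [c cab] := MVT_segment (ltW ab) (fun y _ => dP y)
    (continuous_subspaceT (fun y => is_derive_continuous (dP y))).
  by rewrite Fab// mulr0 mul0r => /eqP; rewrite subr_eq0 => /eqP.
have E2 : exp_primitive (F \o -%R) (- a) = exp_primitive (F \o -%R) (- b).
  have ba : - b <= - a by rewrite lerN2 ltW.
  have [c] := MVT_segment ba (fun y _ => dPN y)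
    (continuous_subspaceT (fun y => is_derive_continuous (dPN y))).
  rewrite in_itv/= => /andP[c1 c2]; rewrite /= Fab ?mulr0 ?mul0r; last first.
    by rewrite lerNr c2 lerNl c1.
  by move=> /eqP; rewrite subr_eq0 => /eqP.
(* A zero of the derivative at x reads e^{2 x} Q = P. With the same P and Q at a and b, subtraction
   gives (e^{2 b} - e^{2 a}) Q = 0, hence Q = 0. *)
have expE x P Q : expR x / 2 * Q - expR (- x) / 2 * P = 0 -> expR x * expR x * Q = P.
  move=> /eqP; rewrite subr_eq0 => /eqP h.
  have e1 : expR x * expR (- x) = 1 by rewrite -expRD subrr expR0.
  transitivity (expR x * 2 * (expR x / 2 * Q)); first by field.
  by rewrite h; transitivity (expR x * expR (- x) * P); [field|rewrite e1 mul1r].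
have {}da := expE _ _ _ da; have {}db := expE _ _ _ db.
have Q0 : exp_primitive (F \o -%R) (- a) = 0.
  have : (expR b * expR b - expR a * expR a) * exp_primitive (F \o -%R) (- a) = 0.
    by rewrite mulrBl da {1}E2 db E1 subrr.
  move=> /eqP; rewrite mulf_eq0 => /orP[|/eqP//]; rewrite subr_eq0 -!expRD => /eqP h.
  have := @expR_inj R _ _ h; lra.
have P0 : exp_primitive F a = 0 by rewrite -da Q0 mulr0.
(* The value of [Lambda_inv2 F] at the single point a integrates the non-negative continuous F
   against a positive kernel, so its vanishing forces F = 0 on the whole line. *)
have L0 : \int[mu]_y (expR (- `|a - y|) / 2 * F y) = 0.
  by rewrite -/(Lambda_inv2 F a) (Lambda_inv2E a cF F0 FM) P0 Q0 !mulr0 addr0.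
have k0 y : 0 <= expR (- `|a - y|) / 2 * F y by rewrite !mulr_ge0 ?expR_ge0.
have ck : continuous (fun y => expR (- `|a - y|) / 2 * F y).
  move=> y; apply: cvgM; last exact: cF.
  apply: cvgMl; apply: (@continuous_comp _ _ _ (fun y => - `|a - y|) (@expR R));
    last exact: continuous_expR.
  apply: cvgN; apply: (@continuous_comp _ _ _ (fun y => a - y) (fun u : R => `|u|));
    last exact: norm_continuous.
  by apply: cvgB; [exact: cvg_cst|exact: cvg_id].
move=> y; have /eqP := ge0_Rintegral_eq0 ck k0 (green_integrable a cF FM) L0 y.
by rewrite mulf_eq0 gt_eqF ?divr_gt0 ?expR_gt0//= => /eqP.
Qed.

End HelmholtzInverse.

(** * Flux and mass *)

Section Flux.
Context {R : realType}.
Local Notation mu := (@lebesgue_measure R).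
Implicit Types (f g : R -> R) (e x y z M d s N : R).

Lemma ae_mono (P Q : R -> Prop) : (forall x, P x -> Q x) ->
  {ae mu, forall x, P x} -> {ae mu, forall x, Q x}.
Proof.
move=> PQ [N [mN N0 sub]]; exists N; split=> // x /= nQ; apply: sub => /= Px.
by apply: nQ; exact: PQ.
Qed.

(** The truncated transforms are integrals, unaffected by null sets, so the same pair a, b serves
    for g. *)
Lemma is_fourier_ae f g a b : measurable_fun setT g ->
  {ae mu, forall x, f x = g x} -> is_fourier f a b -> is_fourier g a b.
Proof.
move=> mg fg [Lf La Lb ca cb].
have [mf if2] := (L2P _).1 Lf.
have Lg : L2 g.
  apply/L2P; split => //; apply/integrableP; split.
    by apply/measurable_EFinP; exact: measurable_funX.
  have /integrableP[_] := if2; congr (_ < _)%E.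
  apply: ae_eq_integral => //.
  - by apply/measurable_EFinP; apply: measurableT_comp => //; exact: measurable_funX.
  - by apply/measurable_EFinP; apply: measurableT_comp => //; exact: measurable_funX.
  - by apply: ae_mono fg => x /= ->.
have trunc n (k : R -> R) : measurable_fun setT k ->
    \int[mu]_(x in `[- n%:R, n%:R]) (f x * k x) =
    \int[mu]_(x in `[- n%:R, n%:R]) (g x * k x).
  move=> mk; congr fine; apply: ae_eq_integral => //.
  - by apply/measurable_EFinP; apply: measurable_funTS; exact: measurable_funM.
  - by apply/measurable_EFinP; apply: measurable_funTS; exact: measurable_funM.
  - by apply: ae_mono fg => x /= ->.
have Ere n : fourier_trunc_re f n = fourier_trunc_re g n.
  apply/funext => xi; congr (_ * _); apply: (trunc n (fun x => cos (x * xi))).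
  by under eq_fun do rewrite mulrC; exact: measurable_cosM.
have Eim n : fourier_trunc_im f n = fourier_trunc_im g n.
  apply/funext => xi; congr (- (_ * _)); apply: (trunc n (fun x => sin (x * xi))).
  by under eq_fun do rewrite mulrC; exact: measurable_sinM.
split=> //.
- by under eq_fun do rewrite -Ere.
- by under eq_fun do rewrite -Eim.
Qed.

(** Allows an expression known only almost everywhere through the equation to be exchanged for a
    continuous one, to which the sup bound applies. *)
Lemma Hs_norm_ae_le s f g : measurable_fun setT g ->
  {ae mu, forall x, f x = g x} -> (Hs_norm s g <= Hs_norm s f)%E.
Proof.
move=> mg fg; apply: ereal_inf_le_tmp => N [a [b [fab ->]]].
by exists a, b; split => //; exact: is_fourier_ae fab.
Qed.

Lemma ereal_cvg0_lt (T : Type) (F : set_system T) {FF : Filter F} (f : T -> \bar R) e :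
  0 < e -> f x @[x --> F] --> 0%E -> \forall x \near F, (f x < e%:E)%E.
Proof.
move=> e0 /fine_cvgP[ffin /cvgr0_norm_lt /(_ _ e0) fe].
apply: filterS2 ffin fe => x fx hx.
by rewrite -(fineK fx) lte_fin (le_lt_trans (ler_norm _)).
Qed.

Definition strain f y := 3 / 2 * derive1 f y ^+ 2.

Definition flux f x := f x ^+ 2 / 2 + Lambda_inv2 (strain f) x.

(** The equation reads u_t = - [dflux] u almost everywhere. The explicit [dLambda_inv2] stands in
    for [derive1] because its continuity is at hand. *)
Definition dflux f x := f x * derive1 f x + dLambda_inv2 (strain f) x.

Definition C1_bounded f M := [/\ forall x, derivable f x 1, continuous (derive1 f),
  forall x, `|f x| <= M & forall x, `|derive1 f x| <= M].

Lemma strain_ge0 f y : 0 <= strain f y.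
Proof. by rewrite mulr_ge0 ?divr_ge0 ?sqr_ge0. Qed.

Lemma continuous_strain f : continuous (derive1 f) -> continuous (strain f).
Proof. by move=> cf x; apply: cvgMr; apply: cvgM; exact: cf. Qed.

Lemma strain_le f M y : (forall x, `|derive1 f x| <= M) -> `|strain f y| <= 3 / 2 * M ^+ 2.
Proof.
move=> fM; rewrite ger0_norm ?strain_ge0// ler_wpM2l ?divr_ge0//.
rewrite -[leLHS]real_normK ?num_real// lerXn2r ?nnegrE//.
by rewrite (le_trans _ (fM y)).
Qed.

Lemma C1_bounded_continuous f M : C1_bounded f M -> continuous f.
Proof.
by case=> df _ _ _ x; apply: differentiable_continuous; apply/derivable1_diffP.
Qed.

Lemma is_derive_flux f M x : C1_bounded f M -> is_derive x (1 : R) (flux f) (dflux f x).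
Proof.
case=> df cdf _ dfM.
have dfx : is_derive x (1 : R) f (derive1 f x) by apply: DeriveDef; rewrite ?derive1E.
have dL := is_derive_Lambda_inv2 x (continuous_strain cdf) (strain_ge0 f)
  (fun y => strain_le y dfM).
rewrite /flux; apply: is_derive_eq; rewrite /GRing.scale/= /dflux.
by field.
Qed.

Lemma continuous_dflux f M : C1_bounded f M -> continuous (dflux f).
Proof.
move=> hf x; have cf := C1_bounded_continuous hf; case: hf => df cdf _ dfM.
apply: cvgD; first by apply: cvgM; [exact: cf|exact: cdf].
exact: (continuous_dLambda_inv2 (continuous_strain cdf) (fun y => strain_le y dfM)).
Qed.

Lemma flux_vanishes f M : C1_bounded f M -> vanishes_at_infinity f ->
  vanishes_at_infinity (derive1 f) -> vanishes_at_infinity (flux f).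
Proof.
move=> [df cdf fM dfM] vf vdf e e0.
have e2 : 0 < e / 2 by rewrite divr_gt0.
have M0 : 0 <= M by exact: le_trans (fM 0).
(* M + 1 stays positive when M = 0. In each quadratic term one factor is bounded by it and the other
   is small. *)
have M1 : 0 < M + 1 by rewrite ltr_wpDl.
have vF : vanishes_at_infinity (strain f).
  move=> h h0; have hM : 0 < h / (2 * (M + 1)) by rewrite divr_gt0// mulr_gt0.
  have [L hL] := vdf _ hM; exists L => x /hL hx.
  rewrite /strain normrM normrX expr2 (@ger0_norm _ (3 / 2)) ?divr_ge0//.
  apply: (@le_trans _ _ (3 / 2 * ((M + 1) * (h / (2 * (M + 1)))))).
    rewrite ler_wpM2l ?divr_ge0//; apply: ler_pM => //.
    by rewrite (le_trans (dfM x))// lerDl.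
  rewrite (_ : (M + 1) * _ = h / 2); [lra|by field; rewrite gt_eqF].
have [L1 h1] := Lambda_inv2_vanishes (continuous_strain cdf) (fun y => strain_le y dfM) vF e2.
have eM : 0 < e / (M + 1) by rewrite divr_gt0.
have [L2 h2] := vf _ eM.
exists (Num.max L1 L2) => x; rewrite ge_max => /andP[/h1 x1 /h2 x2].
rewrite (le_trans (ler_normD _ _))// [leRHS](splitr e) lerD//.
rewrite normrM normrX expr2 (@ger0_norm _ 2^-1)// ler_wpM2r//.
apply: (@le_trans _ _ ((M + 1) * (e / (M + 1)))); last by rewrite mulrC divfK// gt_eqF.
by apply: ler_pM => //; rewrite (le_trans (fM x))// lerDl.
Qed.

(** A difference of squares is at most 2 M d, so the local part contributes M d and, as
    [Lambda_inv2] does not increase sup norms, the non-local part contributes 3 M d. *)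
Lemma flux_dist f g M d x : C1_bounded f M -> C1_bounded g M ->
  (forall y, `|f y - g y| <= d) -> (forall y, `|derive1 f y - derive1 g y| <= d) ->
  `|flux f x - flux g x| <= 4 * M * d.
Proof.
move=> [df cdf fM dfM] [dg cdg gM dgM] fgd dfgd.
have M0 : 0 <= M by exact: le_trans (fM 0).
have sq (u v : R) : `|u| <= M -> `|v| <= M -> `|u - v| <= d -> `|u ^+ 2 - v ^+ 2| <= 2 * M * d.
  move=> uM vM uv; rewrite subr_sqr normrM mulrC; apply: ler_pM => //.
  by rewrite (le_trans (ler_normD _ _))//; lra.
rewrite /flux opprD addrACA (le_trans (ler_normD _ _))//.
rewrite (_ : 4 * M * d = M * d + 3 * M * d); last by ring.
apply: lerD.
  rewrite -mulrBl normrM (@ger0_norm _ 2^-1)// ler_pdivrMr// mulrC mulrA.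
  exact: sq.
apply: (Lambda_inv2_dist x (continuous_strain cdf) (continuous_strain cdg)
  (fun y => strain_le y dfM) (fun y => strain_le y dgM)) => y.
rewrite /strain -mulrBr normrM (@ger0_norm _ (3 / 2)) ?divr_ge0//.
have := sq _ _ (dfM y) (dgM y) (dfgd y); lra.
Qed.

End Flux.

(** * Estimates in time, uniform in space, and the truncated mass *)

Section Evolution.
Context {R : realType}.
Local Notation mu := (@lebesgue_measure R).
Implicit Types (f g : R -> R) (e x y z M d s N t : R) (u v : R -> R -> R).

Lemma ler_norm_dist (x y M d : R) : `|x| <= M -> `|y - x| <= d -> `|y| <= M + d.
Proof. by move=> xM yx; rewrite -[y](subrKC x) (le_trans (ler_normD _ _)) ?lerD. Qed.

Lemma Hs_profile s f : 3 / 2 < s -> continuous f -> Hs s f ->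
  [/\ exists M, C1_bounded f M, vanishes_at_infinity f &
      vanishes_at_infinity (derive1 f)].
Proof.
move=> s32 cf [Lf fy]; have s12 : 1 / 2 < s by lra.
have uf := Sobolev_unif_cont s12 cf fy.
have [N hN] := lty_ex fy.
have [C0 C00 h0] := Sobolev_sup s12.
have [C1 C10 h1] := Sobolev_C1 s32.
have [df dfN udf] := h1 f N cf hN.
have vf : vanishes_at_infinity f by exact: L2_unif_cont_vanishes.
split=> //; last exact: unif_cont_derive1_vanishes.
exists (Num.max (C0 * N) (C1 * N)); split.
- exact: df.
- exact: unif_cont_continuous.
- by move=> x; rewrite le_max (h0 f N cf hN).
- by move=> x; rewrite le_max dfN orbT.
Qed.

(** Limits in the definition of a solution are taken within [[0, T[]; at interior times they become
    full limits, and two-sided derivatives in time are available. *)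
Lemma within_near t T (P : R -> Prop) : 0 < t < T ->
  (\forall t' \near within `[0, T[ (nbhs t), P t') -> \forall t' \near t, P t'.
Proof.
move=> /andP[t0 tT] h; rewrite /within /= in h.
have tI0 : t \in `]0, T[ by rewrite in_itv/= t0.
have tI := near_in_itvoo tI0.
near=> t'; have : `[0, T[%classic t'.
  have : t' \in `]0, T[ by near: t'.
  by rewrite /= !in_itv/= => /andP[/ltW -> ->].
by near: t'.
Unshelve. all: by end_near. Qed.

Lemma within_dnear t T (P : R -> Prop) : 0 < t < T ->
  (\forall t' \near within `[0, T[ t^', P t') -> \forall t' \near t^', P t'.
Proof.
move=> t0T h; apply: (@within_near t T (fun t' => t' != t -> P t')) => //.
by apply: (@filterS _ (nbhs t) _ _ _ _ h) => x hx Jx xt; exact: hx.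
Qed.

(** Both embeddings are applied to the difference of two profiles, with [eta] small enough for
    either constant. This closeness of u and u_x, uniform in x, transfers bounds on the flux from
    one time to nearby ones. *)
Lemma C0_Hs_sup s T u t e : 3 / 2 < s -> 0 < t < T ->
  (forall t, `[0, T[%classic t -> continuous (u t)) -> C0_Hs s `[0, T[ u -> 0 < e ->
  \forall t' \near t, forall x,
    `|u t' x - u t x| <= e /\ `|derive1 (u t') x - derive1 (u t) x| <= e.
Proof.
move=> s32 t0T cu [Hu cuHs] e0; have s12 : 1 / 2 < s by lra.
have tJ : `[0, T[%classic t.
  by case/andP: t0T => t0 tT; rewrite /= in_itv/= tT ltW.
have [C0 C00 h0] := Sobolev_sup s12.
have [C1 C10 h1] := Sobolev_C1 s32.
pose eta := Num.min (e / C0) (e / C1).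
have eta0 : 0 < eta by rewrite lt_min !divr_gt0.
have h := ereal_cvg0_lt eta0 (cuHs t tJ).
have inJ : \forall t' \near within `[0, T[ (nbhs t), `[0, T[%classic t' by exact: withinT.
apply: within_near t0T _.
near=> t'.
have t'J : `[0, T[%classic t' by near: t'.
have [N hN] := lty_ex (Hu t tJ).2; have [N' hN'] := lty_ex (Hu t' t'J).2.
have [df _ _] := h1 _ _ (cu t tJ) hN; have [df' _ _] := h1 _ _ (cu t' t'J) hN'.
have hd : (Hs_norm s (fun x => (u t' x - u t x)%R) < eta%:E)%E by near: t'; exact: h.
have cd : continuous (fun x => u t' x - u t x).
  by move=> x; apply: cvgB; [exact: cu|exact: cu].
have [_ hdd _] := h1 _ _ cd hd.
have le0 : C0 * eta <= e by rewrite mulrC -ler_pdivlMr// /eta ge_min lexx.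
have le1 : C1 * eta <= e by rewrite mulrC -ler_pdivlMr// /eta ge_min lexx orbT.
move=> x; split; first exact: le_trans (h0 _ _ cd hd x) le0.
rewrite -(_ : derive1 (fun x => u t' x - u t x) x = derive1 (u t') x - derive1 (u t) x).
  exact: le_trans (hdd x) le1.
by rewrite !derive1E (deriveB (df' x) (df x)).
Unshelve. all: by end_near. Qed.

(** The quotient tends to [v t] in H^(s-1), and s - 1 > 1/2 provides a sup bound, but only for
    continuous functions. The equation identifies [v t] almost everywhere with the continuous
    [- dflux (u t)]; the norm does not see the exchange. *)
Lemma quotient_sup s T u v t e : 3 / 2 < s -> 0 < t < T ->
  (forall t, `[0, T[%classic t -> continuous (u t)) -> C0_Hs s `[0, T[ u ->
  C1_Hs (s - 1) `[0, T[ u v ->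
  {ae mu, forall x, v t x + u t x * derive1 (u t) x
    + derive1 (Lambda_inv2 (strain (u t))) x = 0} -> 0 < e ->
  \forall t' \near t^', forall x,
    `|(t' - t)^-1 * (u t' x - u t x) + dflux (u t) x| <= e.
Proof.
move=> s32 t0T cu [Hu _] [_ _ du] eqn e0; have s12 : 1 / 2 < s - 1 by lra.
have tJ : `[0, T[%classic t.
  by case/andP: t0T => t0 tT; rewrite /= in_itv/= tT ltW.
have [[M hM] _ _] := Hs_profile s32 (cu t tJ) (Hu t tJ).
have [C C0 hC] := Sobolev_sup s12.
have eC : 0 < e / C by rewrite divr_gt0.
have h := ereal_cvg0_lt eC (du t tJ).
have inJ : \forall t' \near within `[0, T[ t^', `[0, T[%classic t' by exact: withinT.
apply: within_dnear t0T _.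
near=> t'.
have t'J : `[0, T[%classic t' by near: t'.
have ht' : (Hs_norm (s - 1) (fun x => ((t' - t)^-1 * (u t' x - u t x) - v t x)%R) < (e / C)%:E)%E.
  by near: t'; exact: h.
have cg : continuous (fun x => (t' - t)^-1 * (u t' x - u t x) + dflux (u t) x).
  move=> x; apply: cvgD; last exact: (continuous_dflux hM).
  by apply: cvgMr; apply: cvgB; [exact: (cu t' t'J)|exact: (cu t tJ)].
have fg : {ae mu, forall x, (t' - t)^-1 * (u t' x - u t x) - v t x =
    (t' - t)^-1 * (u t' x - u t x) + dflux (u t) x}.
  apply: ae_mono eqn => x E; congr (_ + _).
  have [df cdf _ dfM] := hM.
  (* [derive1] is a total function, so differentiability is supplied before it is replaced by
     [dLambda_inv2]. *)
  have dL := is_derive_Lambda_inv2 x (continuous_strain cdf) (strain_ge0 (u t))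
    (fun y => strain_le y dfM).
  move: E; rewrite [X in _ + X]derive1E derive_val -addrA => /eqP.
  by rewrite addrC addr_eq0 => /eqP <-; rewrite /dflux.
have hg : (Hs_norm (s - 1) (fun x => ((t' - t)^-1 * (u t' x - u t x) + dflux (u t) x)%R)
    < (e / C)%:E)%E.
  by apply: le_lt_trans ht'; apply: Hs_norm_ae_le fg; exact: continuous_measurable_fun.
move=> x; have := hC _ _ cg hg x.
by rewrite [C * _]mulrC divfK// gt_eqF.
Unshelve. all: by end_near. Qed.

(** Truncated, since a function in H^s need not be integrable over the line. *)
Definition mass f (n : nat) := \int[mu]_(x in `[- n%:R, n%:R]) f x.

(** The uniform convergence in [quotient_sup] can be integrated over a bounded interval, and the
    integral of [dflux] is a difference of boundary values of [flux]. *)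
Lemma is_derive_mass s T u v t n : 3 / 2 < s -> 0 < t < T ->
  (forall t, `[0, T[%classic t -> continuous (u t)) -> C0_Hs s `[0, T[ u ->
  C1_Hs (s - 1) `[0, T[ u v ->
  {ae mu, forall x, v t x + u t x * derive1 (u t) x
    + derive1 (Lambda_inv2 (strain (u t))) x = 0} ->
  is_derive t 1 (fun t => mass (u t) n) (flux (u t) (- n%:R) - flux (u t) n%:R).
Proof.
move=> s32 t0T cu Hu C1u eqn.
have tJ : `[0, T[%classic t.
  by case/andP: t0T => t0 tT; rewrite /= in_itv/= tT ltW.
have [[M hM] _ _] := Hs_profile s32 (cu t tJ) (Hu.1 t tJ).
have n0 : - n%:R <= n%:R :> R by rewrite ge0_cp.
have cdf := continuous_dflux hM.
have E : flux (u t) (- n%:R) - flux (u t) n%:R = - \int[mu]_(x in `[- n%:R, n%:R]) dflux (u t) x.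
  by rewrite (Rintegral_FTC2 n0 cdf (fun x => is_derive_flux x hM)) opprB.
rewrite E.
suff h : forall e, 0 < e -> \forall t' \near t^',
    `|- (\int[mu]_(x in `[- n%:R, n%:R]) dflux (u t) x) -
      (t' - t)^-1 * (mass (u t') n - mass (u t) n)| <= e.
  have lim : h^-1 *: (mass (u (h *: (1 : R) + t)) n - mass (u t) n) @[h --> 0^'] -->
      - \int[mu]_(x in `[- n%:R, n%:R]) dflux (u t) x.
    apply/cvgrPdist_le => e /h [d /= d0 hd].
    exists d => //= k /= kd k0.
    have := hd (k + t); rewrite /= addrK /GRing.scale/= mulr1; apply.
      by rewrite opprD addrCA subrr addr0 -sub0r.
    by rewrite -subr_eq0 addrK.
  apply: DeriveDef; first by apply/cvg_ex; eexists; exact: lim.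
  by apply: cvg_lim lim => //; exact: Rhausdorff.
move=> e e0.
(* The interval has length 2 n; the [+ 1] covers n = 0. *)
have n1 : 0 < 2 * n%:R + 1 :> R by rewrite ltr_wpDl// mulr_ge0.
have en : 0 < e / (2 * n%:R + 1) by rewrite divr_gt0.
have inJ : \forall t' \near t^', `[0, T[%classic t'.
  by apply: within_dnear t0T _; exact: withinT.
have hq := quotient_sup s32 t0T cu Hu C1u eqn en.
near=> t'.
have t'J : `[0, T[%classic t' by near: t'.
have ht' : forall x, `|(t' - t)^-1 * (u t' x - u t x) + dflux (u t) x| <= e / (2 * n%:R + 1).
  by near: t'; exact: hq.
have i1 := continuous_integrable_itv (- n%:R) n%:R (cu t' t'J).
have i2 := continuous_integrable_itv (- n%:R) n%:R (cu t tJ).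
have i3 := continuous_integrable_itv (- n%:R) n%:R cdf.
rewrite -opprD normrN addrC /mass -RintegralB// -RintegralZl//; last exact: integrableB_real.
rewrite -RintegralD//; last by apply: integrableZ_real => //; exact: integrableB_real.
apply: (@le_trans _ _ (e / (2 * n%:R + 1) * (n%:R - - n%:R))).
  apply: Rintegral_le_cst => //.
    by apply: integrableD_real => //; apply: integrableZ_real => //; exact: integrableB_real.
rewrite mulrAC ler_pdivrMr// ler_wpM2l ?(ltW e0)// opprK.
by rewrite (_ : n%:R + n%:R = 2 * n%:R) ?lerDl// mulr_natl mulr2n.
Unshelve. all: by end_near. Qed.

(** Decay of the flux at the single time t fixes L; at nearby times the flux differs by at most e /
    2, uniformly in x. As d <= 1, the bound M + 1 holds for all these profiles. The joint
    neighbourhood in t' and n is the form that compactness of a time interval consumes. *)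
Lemma flux_vanishes_locally s T u t e : 3 / 2 < s -> 0 < t < T ->
  (forall t, `[0, T[%classic t -> continuous (u t)) -> C0_Hs s `[0, T[ u -> 0 < e ->
  \forall t' \near t & n \near \oo,
    `|flux (u t') n%:R| <= e /\ `|flux (u t') (- n%:R)| <= e.
Proof.
move=> s32 t0T cu Hu e0.
have tJ : `[0, T[%classic t.
  by case/andP: t0T => t0 tT; rewrite /= in_itv/= tT ltW.
have [[M hM] vf vdf] := Hs_profile s32 (cu t tJ) (Hu.1 t tJ).
have e2 : 0 < e / 2 by rewrite divr_gt0.
have [L hL] := flux_vanishes hM vf vdf e2.
have M0 : 0 <= M by have [_ _ fM _] := hM; exact: le_trans (fM 0).
have M1 : 0 < 4 * (M + 1) by rewrite mulr_gt0// ltr_wpDl.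
pose d := Num.min 1 (e / 2 / (4 * (M + 1))).
have d0 : 0 < d by rewrite lt_min ltr01 divr_gt0.
have inJ : \forall t' \near t, `[0, T[%classic t'.
  by apply: within_near t0T _; exact: withinT.
have near_t := C0_Hs_sup s32 t0T cu Hu d0.
exists ([set t' | `[0, T[%classic t' /\ forall x,
    `|u t' x - u t x| <= d /\ `|derive1 (u t') x - derive1 (u t) x| <= d],
   [set n | L <= n%:R]).
  by split; [exact: filterI|exact: nbhs_infty_ger].
move=> [t' n] [/= [t'J ht'] Ln].
have hM1 : C1_bounded (u t) (M + 1).
  by case: hM => df cdf fM dfM; split => // x; rewrite (le_trans _ (_ : M <= M + 1)) ?lerDl.
have d1 : d <= 1 by rewrite ge_min lexx.
have hM' : C1_bounded (u t') (M + 1).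
  have [[M' [df' cdf' _ _]] _ _] := Hs_profile s32 (cu t' t'J) (Hu.1 t' t'J).
  case: hM => _ _ fM dfM; split => // x; have [hx dhx] := ht' x.
    exact: ler_norm_dist (fM x) (le_trans hx d1).
  exact: ler_norm_dist (dfM x) (le_trans dhx d1).
have md : 4 * (M + 1) * d <= e / 2.
  by rewrite mulrC -ler_pdivlMr// /d ge_min lexx orbT.
have key x : L <= `|x| -> `|flux (u t') x| <= e.
  move=> /hL hx.
  have hd := flux_dist x hM' hM1 (fun y => (ht' y).1) (fun y => (ht' y).2).
  by rewrite [leRHS](splitr e); exact: ler_norm_dist hx (le_trans hd md).
by split; apply: key; rewrite ?normrN ger0_norm.
Qed.

End Evolution.

(** * Unique continuation *)

Section UniqueContinuation.
Context {R : realType}.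
Local Notation mu := (@lebesgue_measure R).
Implicit Types (f g : R -> R) (a b e x y z M d s t T : R) (u v : R -> R -> R).

(** A positive value at z gives a mass of at least (f z / 2) (d / 2) on an interval contained in
    [-n, n] for all large n, and by the sign of f nothing compensates it. *)
Lemma ge0_mass_eq0 f : continuous f -> (forall x, 0 <= f x) ->
  (forall e, 0 < e -> \forall n \near \oo, `|mass f n| <= e) -> forall x, f x = 0.
Proof.
move=> cf f0 mf z; apply/eqP; rewrite eq_le f0 andbT leNgt; apply/negP => fz.
have fz2 : 0 < f z / 2 by rewrite divr_gt0.
have /cvgrPdist_le /(_ _ fz2) [d /= d0 hd] := cf z.
have c0 : 0 < f z / 2 * (d / 2) by rewrite mulr_gt0// divr_gt0.
have c2 : 0 < f z / 2 * (d / 2) / 2 by rewrite divr_gt0.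
near \oo => n.
have hn : `|mass f n| <= f z / 2 * (d / 2) / 2 by near: n; exact: mf.
have nz : `|z| + d <= n%:R by near: n; exact: nbhs_infty_ger.
have low : f z / 2 * (z + d / 2 - z) <= \int[mu]_(x in `[z, z + d / 2]) f x.
  apply: Rintegral_ge_cst.
  - by rewrite lerDl divr_ge0// ltW.
  - exact: continuous_integrable_itv.
  - move=> x /andP[zx xd]; have : `|f z - f x| <= f z / 2.
      apply: hd => /=; rewrite distrC ger0_norm ?subr_ge0//; lra.
    by rewrite ler_norml => /andP[_]; lra.
have sub : \int[mu]_(x in `[z, z + d / 2]) f x <= mass f n.
  apply: Rintegral_subset_le => //; last exact: continuous_integrable_itv.
  move: nz; set N : R := n%:R => nz.
  move=> x /=; rewrite !in_itv/= => /andP[zx xd].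
  rewrite -[- n%:R]/(- N) -/N; have := ler_norm z; have := ler_norm (- z).
  rewrite normrN => h1 h2.
  by apply/andP; split; lra.
have absurd (p q m : R) : 0 < p -> p <= q -> q <= m -> m <= p / 2 -> False.
  by clear; lra.
rewrite [z + _ in X in X <= _]addrC addrK in low.
exact: absurd c0 low sub (le_trans (ler_norm _) hn).
Unshelve. all: by end_near. Qed.

Lemma mass_eq0 f : continuous f -> (forall x, 0 <= f x) \/ (forall x, f x <= 0) ->
  (forall e, 0 < e -> \forall n \near \oo, `|mass f n| <= e) -> forall x, f x = 0.
Proof.
move=> cf [f0|f0] mf; first exact: ge0_mass_eq0.
have cfN : continuous (fun x => - f x) by move=> x; apply: cvgN; exact: cf.
move=> x; apply/eqP; rewrite -oppr_eq0; apply/eqP.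
apply: (@ge0_mass_eq0 (fun x => - f x)) => // [y|e /mf]; first by rewrite oppr_ge0.
apply: filterS => n; rewrite /mass.
have -> : \int[mu]_(x in `[- n%:R, n%:R]) (- f x) =
    - \int[mu]_(x in `[- n%:R, n%:R]) f x.
  rewrite -[RHS]mulN1r -RintegralZl//; last exact: continuous_integrable_itv.
  by apply: eq_Rintegral => y _; rewrite mulN1r.
by rewrite normrN.
Qed.

(** Compactness of [[a, b]] merges the local thresholds of [flux_vanishes_locally] into one that is
    valid at all its times; the mean value theorem then bounds the variation by the flux at -n and
    n, each at most e. *)
Lemma mass_variation s T u v a b e : 3 / 2 < s -> 0 < a -> a <= b -> b < T ->
  (forall t, `[0, T[%classic t -> continuous (u t)) -> C0_Hs s `[0, T[ u ->
  C1_Hs (s - 1) `[0, T[ u v ->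
  (forall t, `[0, T[%classic t -> {ae mu, forall x, v t x + u t x * derive1 (u t) x
    + derive1 (Lambda_inv2 (strain (u t))) x = 0}) -> 0 < e ->
  \forall n \near \oo, `|mass (u b) n - mass (u a) n| <= 2 * e * (b - a).
Proof.
move=> s32 a0 ab bT cu Hu C1u eqn e0.
have /compact_near_coveringP cpt := @segment_compact R a b.
have := cpt nat \oo (fun n t => `|flux (u t) n%:R| <= e /\ `|flux (u t) (- n%:R)| <= e) _ _.
move=> h; have {}h : \forall n \near \oo, `[a, b] `<=` (fun t =>
    `|flux (u t) n%:R| <= e /\ `|flux (u t) (- n%:R)| <= e).
  apply: h => t; rewrite /= in_itv/= => /andP[at0 tb].
  apply: (flux_vanishes_locally s32 _ cu Hu e0).
  by rewrite (lt_le_trans a0 at0) (le_lt_trans tb bT).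
near=> n.
have hn : `[a, b] `<=` (fun t => `|flux (u t) n%:R| <= e /\ `|flux (u t) (- n%:R)| <= e).
  by near: n.
have dm t : a <= t <= b -> is_derive t 1 (fun t => mass (u t) n)
    (flux (u t) (- n%:R) - flux (u t) n%:R).
  move=> /andP[at0 tb]; have t0T : 0 < t < T by rewrite (lt_le_trans a0 at0) (le_lt_trans tb bT).
  apply: (is_derive_mass n s32 t0T cu Hu C1u); apply: eqn.
  by case/andP: t0T => t0 tT; rewrite /= in_itv/= tT ltW.
have dmo t : t \in `]a, b[ -> is_derive t (1 : R) (fun t => mass (u t) n)
    (flux (u t) (- n%:R) - flux (u t) n%:R).
  by rewrite in_itv/= => /andP[/ltW at0 /ltW tb]; apply: dm; rewrite at0.
have cm : {within `[a, b], continuous (fun t => mass (u t) n)}.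
  apply: continuous_in_subspaceT => t; rewrite inE => tab.
  by apply: is_derive_continuous; apply: dm; move: tab; rewrite /= in_itv/=.
have [c] := MVT_segment ab dmo cm.
move=> cab ->; have [h1 h2] := hn c cab.
rewrite normrM (@ger0_norm _ (b - a)) ?subr_ge0// ler_wpM2r ?subr_ge0//.
by rewrite (_ : 2 * e = e + e); [exact: le_trans (ler_normB _ _) (lerD h2 h1)|ring].
Unshelve. all: by end_near. Qed.

Lemma open_vanish_derive1 f (I : set R) x : open I -> I x -> (forall y, I y -> f y = 0) ->
  derive1 f x = 0.
Proof.
move=> oI Ix fI; rewrite derive1E (@near_eq_derive _ _ _ _ (cst 0)) ?derive_cst//.
by near=> y; apply: fI; near: y; exact: open_nbhs_nbhs.
Unshelve. all: by end_near. Qed.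

(** As u vanishes on I at all times near t, the difference quotients are 0 there and [dflux]
    vanishes at every point of I, not just almost everywhere. Since u also vanishes on I, only the
    derivative of the non-local term is left, and the two points a and a + d / 2 suffice. *)
Lemma local_vanish s T u v t (I : set R) : 3 / 2 < s -> 0 < t < T ->
  (forall t, `[0, T[%classic t -> continuous (u t)) -> C0_Hs s `[0, T[ u ->
  C1_Hs (s - 1) `[0, T[ u v ->
  {ae mu, forall x, v t x + u t x * derive1 (u t) x
    + derive1 (Lambda_inv2 (strain (u t))) x = 0} ->
  open I -> I !=set0 ->
  (\forall t' \near t, forall x, I x -> u t' x = 0) -> forall x, u t x = 0.
Proof.
move=> s32 t0T cu Hu C1u eqn oI [a Ia] uI.
have tJ : `[0, T[%classic t.
  by case/andP: t0T => t0 tT; rewrite /= in_itv/= tT ltW.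
have [[M hM] _ _] := Hs_profile s32 (cu t tJ) (Hu.1 t tJ).
have uI0 x : I x -> u t x = 0 by move=> Ix; exact: nbhs_singleton uI x Ix.
have dI0 x : I x -> derive1 (u t) x = 0 by move=> Ix; exact: open_vanish_derive1 uI0.
have dfl x : I x -> dflux (u t) x = 0.
  move=> Ix; apply/eqP; rewrite -normr_le0; apply/ler_addgt0Pr => e e0; rewrite add0r.
  have hq := quotient_sup s32 t0T cu Hu C1u eqn e0.
  have uI' : \forall t' \near t^', forall x, I x -> u t' x = 0.
    by apply: (@filterS _ (nbhs t) _ _ _ _ uI) => t' h _.
  near t^' => t'.
  have ht' : forall x, I x -> u t' x = 0 by near: t'.
  have : `|(t' - t)^-1 * (u t' x - u t x) + dflux (u t) x| <= e.
    by have : forall x, `|(t' - t)^-1 * (u t' x - u t x) + dflux (u t) x| <= e by near: t'.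
  by rewrite ht'// uI0// subrr mulr0 add0r.
have [d /= d0 hd] := open_nbhs_nbhs (conj oI Ia).
have Iad y : a <= y <= a + d / 2 -> I y.
  move=> /andP[ay yd]; apply: hd => /=; rewrite distrC ger0_norm ?subr_ge0//; lra.
have ad : a < a + d / 2 by rewrite ltrDl divr_gt0.
have [df cdf fM dfM] := hM.
have dL x : I x -> dLambda_inv2 (strain (u t)) x = 0.
  by move=> Ix; have := dfl x Ix; rewrite /dflux uI0// mul0r add0r.
have S0 y : a <= y <= a + d / 2 -> strain (u t) y = 0.
  by move=> /Iad Iy; rewrite /strain dI0// expr0n mulr0.
have Ib : I (a + d / 2) by apply: Iad; rewrite lexx ltW.
have := dLambda_inv2_eq0 (continuous_strain cdf) (strain_ge0 (u t))
  (fun y => strain_le y dfM) ad S0 (dL _ Ia) (dL _ Ib).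
move=> strain0.
(* A vanishing [strain] makes u(t, .) constant, and its value at a is 0. *)
have d00 y : derive1 (u t) y = 0.
  have /eqP := strain0 y; rewrite /strain mulf_eq0 expf_eq0 /=.
  by rewrite mulf_eq0 invr_eq0 !pnatr_eq0/= => /eqP.
have dux y : is_derive y (1 : R) (u t) 0.
  by rewrite -(d00 y); apply: DeriveDef; rewrite ?derive1E.
move=> x; transitivity (u t a); last exact: uI0.
exact: is_derive_0_is_cst.
Unshelve. all: by end_near. Qed.

End UniqueContinuation.

(** * The zero solution *)

Section ZeroSolution.
Context {R : realType}.
Local Notation mu := (@lebesgue_measure R).
Implicit Types (s t T x : R) (u v : R -> R -> R) (J : set R).

Lemma L2norm_cst0 : L2norm (fun=> 0 : R) = 0%E.
Proof. by rewrite /L2norm -[RHS](@Lnorm0 _ _ _ mu 2%:E). Qed.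

Lemma is_fourier0 : is_fourier (fun=> 0 : R) (fun=> 0) (fun=> 0).
Proof.
have L20 : L2 (fun=> 0 : R).
  apply: (@L2_bounded_integrable _ _ 0); first exact: integrable0.
  by move=> x; rewrite normr0.
have re0 n : (fun xi => fourier_trunc_re (fun=> 0 : R) n xi - 0) = (fun=> 0).
  apply/funext => xi; rewrite subr0 /fourier_trunc_re.
  by under eq_Rintegral do rewrite mul0r; rewrite Rintegral_cst// mul0r mulr0.
have im0 n : (fun xi => fourier_trunc_im (fun=> 0 : R) n xi - 0) = (fun=> 0).
  apply/funext => xi; rewrite subr0 /fourier_trunc_im.
  by under eq_Rintegral do rewrite mul0r; rewrite Rintegral_cst// mul0r mulr0 oppr0.
split=> //.
- by under eq_fun do rewrite re0 L2norm_cst0; exact: cvg_cst.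
- by under eq_fun do rewrite im0 L2norm_cst0; exact: cvg_cst.
Qed.

Lemma Hs_norm0 s : Hs_norm s (fun=> 0 : R) = 0%E.
Proof.
apply/eqP; rewrite eq_le; apply/andP; split.
  apply: ereal_inf_lbound; exists (fun=> 0), (fun=> 0); split; first exact: is_fourier0.
  rewrite -L2norm_cst0; congr L2norm; apply/funext => xi.
  by rewrite expr0n addr0 sqrtr0 mulr0.
by apply: le_ereal_inf_tmp => _ [a [b [_ ->]]]; exact: Lnorm_ge0.
Qed.

Lemma C0_Hs0 s J : C0_Hs s J (fun _ _ => 0 : R).
Proof.
split=> t _; first by split; [have [] := is_fourier0|rewrite Hs_norm0].
rewrite (_ : (fun t' => _) = fun=> 0%E); first exact: cvg_cst.
by apply/funext => t'; rewrite subr0 Hs_norm0.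
Qed.

Lemma is_solution0 s J : is_solution s J (fun _ _ => 0 : R).
Proof.
split; [by move=> t _ x; exact: cvg_cst|exact: C0_Hs0|].
exists (fun _ _ => 0); split.
  split; [exact: C0_Hs0|exact: C0_Hs0|move=> t _].
  rewrite (_ : (fun t' => _) = fun=> 0%E); first exact: cvg_cst.
  by apply/funext => t'; rewrite subrr mulr0 subr0 Hs_norm0.
move=> t _.
have d0 : derive1 (fun=> 0 : R) = fun=> 0.
  by apply/funext => x; rewrite derive1_cst.
have -> : Lambda_inv2 (fun y => 3 / 2 * derive1 (fun=> 0 : R) y ^+ 2) = fun=> 0.
  apply/funext => x; rewrite /Lambda_inv2 d0.
  under eq_Rintegral do rewrite expr0n !mulr0.
  by rewrite Rintegral_cst// mul0r.
exists set0; split => // x /=; apply: contra_notP => _.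
by rewrite d0 mul0r !addr0.
Qed.

(** The mass argument covers interior times only, where derivatives in time are two-sided. The
    initial time is recovered from right-continuity in H^s and the sup bound. *)
Lemma zero_at_0 s T u : 1 / 2 < s -> 0 < T ->
  (forall t, `[0, T[%classic t -> continuous (u t)) -> C0_Hs s `[0, T[ u ->
  (forall t x, 0 < t < T -> u t x = 0) -> forall x, u 0 x = 0.
Proof.
move=> s12 T0 cu [_ cuHs] u0 x.
have J0 : `[0, T[%classic (0 : R) by rewrite /= in_itv/= lexx.
have [C C0 hC] := Sobolev_sup s12.
apply/eqP; rewrite -normr_le0; apply/ler_addgt0Pr => e e0; rewrite add0r.
have eC : 0 < e / C by rewrite divr_gt0.
have [d /= d0 hd] := ereal_cvg0_lt eC (cuHs 0 J0).
pose t := Num.min (d / 2) (T / 2).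
have t0 : 0 < t by rewrite lt_min !divr_gt0.
have td : t < d by rewrite gt_min; apply/orP; left; lra.
have tT : t < T by rewrite gt_min; apply/orP; right; lra.
have tJ : `[0, T[%classic t by rewrite /= in_itv/= tT ltW.
have := hd t _ tJ; rewrite /= sub0r normrN (gtr0_norm t0) => /(_ td) ht.
have cd : continuous (fun x => u t x - u 0 x).
  by move=> y; apply: cvgB; [exact: (cu t tJ)|exact: (cu 0 J0)].
have := hC _ _ cd ht x; rewrite u0 ?t0// sub0r normrN.
by rewrite [C * _]mulrC divfK// gt_eqF.
Qed.

End ZeroSolution.

Unset Implicit Arguments.

Theorem theorem2p3 (R : realType) (t0 t1 T s : R) (I : set R) (u : R -> R -> R)
    (ht0 : 0 < t0) (ht01 : t0 < t1) (ht1T : t1 < T)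
    (I_nonempty : I !=set0) (I_open : open I) (I_interval : is_interval I)
    (hs : 3 / 2 < s)
    (hu : is_solution s `[0, T[ u)
    (hsign : (forall t x, `[0, T[%classic t -> 0 <= u t x) \/
             (forall t x, `[0, T[%classic t -> u t x <= 0))
    (hOmega : forall t x, (`]t0, t1[ `*` I) (t, x) -> u t x = 0) :
  (forall t x, `[0, T[%classic t -> u t x = 0) /\
  (exists U : R -> R -> R,
     is_solution s `[0, +oo[ U /\
     forall t x, `[0, T[%classic t -> U t x = u t x).
Proof.
case: hu => cu Hu [v [C1u eqn]].
have T0 : 0 < T by lra.
have strainE t : `[0, T[%classic t -> {ae @lebesgue_measure R, forall x,
    v t x + u t x * derive1 (u t) x + derive1 (Lambda_inv2 (strain (u t))) x = 0}.
  exact: eqn.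
(* One time inside the slab is enough: u vanishes on I at all neighbouring times as well. *)
pose tm := (t0 + t1) / 2.
have tm01 : t0 < tm < t1 by rewrite /tm; lra.
have tmT : 0 < tm < T by lra.
have memJ t : 0 < t < T -> `[0, T[%classic t.
  by case/andP => t0' tT; rewrite /= in_itv/= tT ltW.
have um0 : forall x, u tm x = 0.
  apply: (local_vanish hs tmT cu Hu C1u (strainE _ (memJ _ tmT)) I_open I_nonempty).
  have tmI : tm \in `]t0, t1[ by rewrite in_itv/=.
  have := near_in_itvoo tmI; apply: filterS => t tI x Ix; exact: hOmega.
have mass0 n : mass (u tm) n = 0.
  rewrite /mass; under eq_Rintegral do rewrite um0.
  by rewrite Rintegral_cst// mul0r.
have u0 t x : 0 < t < T -> u t x = 0.
  move=> tT; have tJ := memJ _ tT.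
  apply: (mass_eq0 (cu t tJ)).
    by case: hsign => h; [left|right] => y; exact: h.
  move=> e e0; have D0 : 0 < 2 * (`|t - tm| + 1) by rewrite mulr_gt0// ltr_wpDl.
  (* [mass_variation] multiplies this tolerance by 2 |t - tm|, which leaves at most e; the [+ 1]
     covers t = [tm]. *)
  have eD : 0 < e / (2 * (`|t - tm| + 1)) by rewrite divr_gt0.
  have small (r : R) : `|r| <= 2 * (e / (2 * (`|t - tm| + 1))) * `|t - tm| -> `|r| <= e.
    move=> /le_trans; apply; move: (normr_ge0 (t - tm)) => w0.
    have w1 : 0 < `|t - tm| + 1 by rewrite ltr_wpDl.
    have -> : 2 * (e / (2 * (`|t - tm| + 1))) * `|t - tm| = e * `|t - tm| / (`|t - tm| + 1).
      by field; rewrite gt_eqF.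
    by rewrite ler_pdivrMr// ler_wpM2l ?(ltW e0)// lerDl.
  case/andP: tT => tgt0 tltT; case/andP: tmT => tmgt0 tmltT.
  have [ttm|ttm] := leP t tm.
    have := mass_variation hs tgt0 ttm tmltT cu Hu C1u strainE eD.
    apply: filterS => n; rewrite mass0 sub0r normrN => h; apply: small.
    have E : `|t - tm| = tm - t by rewrite distrC ger0_norm ?subr_ge0.
    by rewrite E in h *.
  have := mass_variation hs tmgt0 (ltW ttm) tltT cu Hu C1u strainE eD.
  apply: filterS => n; rewrite mass0 subr0 => h; apply: small.
  have E : `|t - tm| = t - tm by rewrite ger0_norm ?subr_ge0 ?(ltW ttm).
  by rewrite E in h *.
have uJ t x : `[0, T[%classic t -> u t x = 0.
  rewrite /= in_itv/= le_eqVlt => /andP[/orP[/eqP <-|t0'] tT].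
    by apply: (zero_at_0 _ T0 cu Hu u0); lra.
  by apply: u0; rewrite t0'.
(* The global extension is the zero function, a solution on every set of times. *)
split=> //; exists (fun _ _ => 0); split; first exact: is_solution0.
by move=> t x tJ; rewrite uJ.
Qed.
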